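(* The smoothing invariant $$S(K)=\begin{cases}\sum_d\mathrm{sgn}(d)\bigl([K^d_{sm}]-[K^0_{link}]\bigr)&\text{in the unframed case}\\ \sum_d\mathrm{sgn}(d)\,[K^d_{sm}]&\text{in the framed case}\end{cases}$$ (sums over all classical crossings $d$ of $K$) is a Vassiliev invariant of order one of long virtual knots, both in the framed and in the unframed category.
   Context: A long virtual knot diagram is an immersion $\mathbb{R}\to\mathbb{R}^2$ which coincides with the $x$-axis outside some closed ball centered at the origin and whose double points are decorated either as classical crossings (with over/under information, hence a sign $\mathrm{sgn}=\pm1$) or as virtual crossings. Long virtual knots (unframed) are diagrams modulo the classical Reidemeister moves 1, 2, 3, the purely virtual Reidemeister moves 1, 2, 3, and the mixed move (sliding an arc carrying only virtual crossings past a classical crossing). Framed long virtual knots are defined in the same way, except that classical Reidemeister move 1 is replaced by the framed Reidemeister move 1, which inserts or removes on an arc two consecutive kinks whose classical crossings have opposite signs. Two-component virtual tangles (one long component and one closed component) are defined in the same way. The flat equivalence class $[\cdot]$ is the class modulo the moves of the category together with crossing changes at classical crossings. For a diagram $K$ and a classical crossing $d$, $K^d_{sm}$ is the two-component virtual tangle obtained by smoothing $d$ according to orientation, and $[K^0_{link}]$ is the flat class of the union of $K$ with an unlinked copy of the unknot. $S(K)$ takes values in the free abelian group generated by flat equivalence classes of such tangles. A knot invariant $\nu$ with values in an abelian group is extended to singular long virtual knots (with transverse double points, up to the classical Reidemeister moves 2, 3, the purely virtual Reidemeister moves 1, 2, 3, the mixed move, the classical Reidemeister move 1 in the unframed category or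 the framed Reidemeister move 1 in the framed category, and rigid vertex isotopy) by $\nu(K_\bullet)=\nu(K_+)-\nu(K_-)$, where $K_\pm$ replace a double point by a positive/negative crossing. It is a Vassiliev (finite-type) invariant of order $\le n$ if it vanishes on all knots with more than $n$ double points; it has order one if it has order $\le1$ but is not of order $\le0$, i.e. it is nonzero on some knot with exactly one double point.
   Formalization: In the framed case too, the flat classes [·] of two-component tangles are taken modulo the ordinary (unframed) Reidemeister move 1, since modulo only the framed move 1 the sum S would not be invariant under Reidemeister move 2 between antiparallel strands. *)

(* Defs.v *)
(* Written over MathComp; boolp is used only for the quotient by a Prop-valued *)
(* equivalence relation.                                                      *)
From HB Require Import structures.
From Stdlib Require Import Relations.
From mathcomp Require Import all_boot all_order all_algebra.
From mathcomp Require Import boolp zify.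
From mathcomp.multinomials Require Import freeg.

Set Implicit Arguments.
Unset Strict Implicit.
Unset Printing Implicit Defensive.

Import GRing.Theory.

Local Open Scope ring_scope.
Local Open Scope quotient_scope.

(* A diagram is an immersed curve in the plane in general position with       *)
(* respect to the projection onto the x-axis.  It is cut by vertical lines    *)
(* into slices, read from left to right, each containing one crossing or one  *)
(* point with vertical tangent.  On a vertical line the strands are numbered  *)
(* from bottom to top, starting at 0.  An orientation is a boolean: true for  *)
(* a strand running from left to right, false for right to left.              *)

(* In a crossing one strand ascends (from height h on the left to h+1 on the  *)
(* right) and the other one descends; Classical o is a classical crossing in  *)
(* which the ascending strand passes over iff o = true.  Double is a          *)
(* transverse double point of a singular diagram.                             *)
Inductive kind := Classical of bool | Virtual | Double.

(* Cross k h a b : the strands at heights h and h+1 on the left, of           *)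
(*                 orientations a and b, cross;                               *)
(* Cap h a       : the strands at heights h and h+1, of orientations a and    *)
(*                 ~~ a, are joined and do not continue to the right;         *)
(* Cup h a       : two joined strands, of orientations a and ~~ a, appear at  *)
(*                 heights h and h+1.                                         *)
Inductive slice :=
  | Cross of kind & nat & bool & bool
  | Cap of nat & bool
  | Cup of nat & bool.

Definition kind_code (k : kind) : option (option bool) :=
  match k with Classical o => Some (Some o) | Virtual => Some None | Double => None end.
Definition kind_decode (c : option (option bool)) : kind :=
  match c with Some (Some o) => Classical o | Some None => Virtual | None => Double end.
Lemma kind_codeK : cancel kind_code kind_decode. Proof. by case. Qed.
HB.instance Definition _ := Countable.copy kind (can_type kind_codeK).

Definition slice_code (s : slice) : (kind * nat * bool * bool) + (bool * nat * bool) :=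
  match s with
  | Cross k h a b => inl (k, h, a, b)
  | Cap h a => inr (true, h, a)
  | Cup h a => inr (false, h, a)
  end.
Definition slice_decode (c : (kind * nat * bool * bool) + (bool * nat * bool)) : slice :=
  match c with
  | inl (k, h, a, b) => Cross k h a b
  | inr (true, h, a) => Cap h a
  | inr (false, h, a) => Cup h a
  end.
Lemma slice_codeK : cancel slice_code slice_decode. Proof. by case. Qed.
HB.instance Definition _ := Countable.copy slice (can_type slice_codeK).

Definition height (s : slice) : nat :=
  match s with Cross _ h _ _ => h | Cap h _ => h | Cup h _ => h end.
Definition lhs (s : slice) : seq bool :=
  match s with
  | Cross _ _ a b => [:: a; b] | Cap _ a => [:: a; ~~ a] | Cup _ _ => [::]
  end.
Definition rhs (s : slice) : seq bool :=
  match s with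
  | Cross _ _ a b => [:: b; a] | Cap _ _ => [::] | Cup _ a => [:: a; ~~ a]
  end.
Definition raise (n : nat) (s : slice) : slice :=
  match s with
  | Cross k h a b => Cross k (h + n) a b
  | Cap h a => Cap (h + n) a
  | Cup h a => Cup (h + n) a
  end.

(* w : the orientations of the strands on the left of the slice; None if the  *)
(* slice does not fit there.                                                  *)
Definition step (w : seq bool) (s : slice) : option (seq bool) :=
  let h := height s in let m := size (lhs s) in
  if (h <= size w)%N && (take m (drop h w) == lhs s)
  then Some (take h w ++ rhs s ++ drop (h + m) w) else None.

Fixpoint run (w : seq bool) (D : seq slice) : option (seq bool) :=
  if D is s :: D' then obind (run^~ D') (step w s) else Some w.

(* One strand running to the right at both ends: one long component, and any  *)
(* number of closed ones.                                                     *)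
Definition valid (D : seq slice) : bool := run [:: true] D == Some [:: true].

Definition is_classical (s : slice) : bool :=
  if s is Cross (Classical _) _ _ _ then true else false.
Definition is_double (s : slice) : bool :=
  if s is Cross Double _ _ _ then true else false.
Definition doubles (D : seq slice) : nat := count is_double D.

(* Number of closed components.  While sweeping from left to right, R i j     *)
(* records whether the strands at heights i and j belong to the same          *)
(* component of the part of the diagram already swept.  A closed component is *)
(* completed by the one cap whose two ends are already joined.                *)
Definition transp (p q i : nat) : nat := if i == p then q else if i == q then p else i.
Definition skip (h i : nat) : nat := if (i < h)%N then i else i.+2.
Definition unskip (h i : nat) : nat := if (i < h)%N then i else i.-2.

Definition join (R : rel nat) (s : slice) : rel nat := fun i j =>
  match s with
  | Cross _ h _ _ => R (transp h h.+1 i) (transp h h.+1 j)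
  | Cap h _ =>
      let x := skip h i in let y := skip h j in
      [|| R x y, R x h && R h.+1 y | R x h.+1 && R h y]
  | Cup h _ =>
      let new x := (x == h) || (x == h.+1) in
      if new i || new j then new i && new j else R (unskip h i) (unskip h j)
  end.
Definition closes (R : rel nat) (s : slice) : bool :=
  if s is Cap h _ then R h h.+1 else false.
Fixpoint closings (R : rel nat) (D : seq slice) : nat :=
  if D is s :: D' then (closes R s + closings (join R s) D')%N else 0%N.
Definition closed_components (D : seq slice) : nat := closings (fun _ _ => true) D.

(* Singular long virtual knot diagrams, long virtual knot diagrams, and       *)
(* diagrams of two-component virtual tangles.                                 *)
Definition is_singular_knot (D : seq slice) : bool :=
  valid D && (closed_components D == 0%N).
Definition is_long_knot (D : seq slice) : bool :=
  is_singular_knot D && (doubles D == 0%N).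
Definition is_tangle (D : seq slice) : bool :=
  [&& valid D, closed_components D == 1%N & doubles D == 0%N].

Definition singular_knot := {D : seq slice | is_singular_knot D}.
Definition long_knot := {D : seq slice | is_long_knot D}.
Definition tangle := {D : seq slice | is_tangle D}.

Lemma long_knot_singular (K : long_knot) : is_singular_knot (val K).
Proof. by case/andP: (valP K). Qed.
Definition singular_of (K : long_knot) : singular_knot := Sub (val K) (long_knot_singular K).

Inductive category := Unframed | Framed.

Definition flip (k : kind) : kind := if k is Classical o then Classical (~~ o) else k.

(* A kink on the strand of orientation a at height h; its loop lies above     *)
(* (up = true) or below the strand.                                           *)
Definition kink (up : bool) (k : kind) (h : nat) (a : bool) : seq slice :=
  if up then [:: Cup h.+1 a; Cross k h a a; Cap h.+1 a]
  else [:: Cup h (~~ a); Cross k h.+1 a a; Cap h (~~ a)].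

(* Three strands, numbered 1, 2, 3 from bottom to top on the left, cross      *)
(* pairwise: triangle k12 k13 k23 says that a strand may be slid across the   *)
(* crossing of the other two.  As the strand with the smaller number ascends  *)
(* in each crossing, o_ij = true means that i passes over j.                  *)
Inductive triangle : kind -> kind -> kind -> Prop :=
  (* classical Reidemeister 3: "over" is acyclic *)
  | tri_classical o12 o13 o23 : ~~ ((o12 == o23) && (o12 != o13)) ->
      triangle (Classical o12) (Classical o13) (Classical o23)
  (* a strand with virtual crossings only: virtual Reidemeister 3 when k is   *)
  (* Virtual, the mixed move when k is Classical, and its analogue for a      *)
  (* rigid vertex when k is Double *)
  | tri_detour12 k : triangle k Virtual Virtual
  | tri_detour13 k : triangle Virtual k Virtual
  | tri_detour23 k : triangle Virtual Virtual k
  (* rigid vertex isotopy: a strand over or under a double point *)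
  | tri_double12 o : triangle Double (Classical o) (Classical o)
  | tri_double13 o : triangle (Classical o) Double (Classical (~~ o))
  | tri_double23 o : triangle (Classical o) (Classical o) Double.

Inductive move (c : category) : seq slice -> seq slice -> Prop :=
  (* planar isotopy: independent slices, births and deaths of vertical        *)
  (* tangents, and a crossing rotated through a vertical tangent *)
  | mv_exchange s t : (height s <= height t)%N ->
      move c [:: s; raise (size (rhs s)) t] [:: raise (size (lhs s)) t; s]
  | mv_zigzag_up h a : move c [:: Cup h a; Cap h.+1 (~~ a)] [::]
  | mv_zigzag_down h a : move c [:: Cup h.+1 a; Cap h (~~ a)] [::]
  | mv_rotate_cap k h a b :
      move c [:: Cross k h a b; Cap h.+1 a]
             [:: Cross (flip k) h.+1 b (~~ a); Cap h a]
  | mv_rotate_cup k h a b :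
      move c [:: Cup h.+1 b; Cross k h a b]
             [:: Cup h b; Cross (flip k) h.+1 (~~ b) a]
  | mv_R1 up o h a : c = Unframed -> move c (kink up (Classical o) h a) [::]
  (* both crossings of the kinks have equal orientations a a, so o and ~~ o   *)
  (* have opposite signs *)
  | mv_framed_R1 up up' o h a : c = Framed ->
      move c (kink up (Classical o) h a ++ kink up' (Classical (~~ o)) h a) [::]
  | mv_R2 o h a b :
      move c [:: Cross (Classical o) h a b; Cross (Classical (~~ o)) h b a] [::]
  | mv_virtual_R1 up h a : move c (kink up Virtual h a) [::]
  | mv_virtual_R2 h a b : move c [:: Cross Virtual h a b; Cross Virtual h b a] [::]
  | mv_triangle k12 k13 k23 h a1 a2 a3 : triangle k12 k13 k23 ->
      move c [:: Cross k12 h a1 a2; Cross k13 h.+1 a1 a3; Cross k23 h a2 a3]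
             [:: Cross k23 h.+1 a2 a3; Cross k13 h a1 a3; Cross k12 h.+1 a1 a2]
  (* rigid vertex isotopy: a double point turned over by a half turn *)
  | mv_vertex_turn o h a b :
      move c [:: Cross Double h a b; Cross (Classical o) h b a]
             [:: Cross (Classical o) h a b; Cross Double h b a].

Inductive flat_move (c : category) : seq slice -> seq slice -> Prop :=
  | fl_move l r : move c l r -> flat_move c l r
  | fl_crossing_change o h a b :
      flat_move c [:: Cross (Classical o) h a b] [:: Cross (Classical (~~ o)) h a b].

Inductive applied (m : seq slice -> seq slice -> Prop) : seq slice -> seq slice -> Prop :=
  | Applied u v l r : m l r -> valid (u ++ l ++ v) -> valid (u ++ r ++ v) ->
      applied m (u ++ l ++ v) (u ++ r ++ v).

Definition equivalent (c : category) := clos_refl_sym_trans _ (applied (move c)).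
Definition flat_equivalent (c : category) := clos_refl_sym_trans _ (applied (flat_move c)).

(* Flat classes of two-component virtual tangles.  Tangles carry no framing,  *)
(* also when they come from a framed knot: in a Reidemeister move 2 between   *)
(* antiparallel strands, smoothing one crossing leaves a kink on the long     *)
(* component and smoothing the other one leaves it on the closed component.   *)
(* With the framed move 1 the two results would be distinguished by the       *)
(* parity of the number of self-crossings of the closed component.            *)
Definition same_flat_class : rel tangle :=
  fun T T' => `[< flat_equivalent Unframed (val T) (val T') >].
Lemma same_flat_class_refl : reflexive same_flat_class.
Proof. by move=> T; apply/asboolP; apply: rst_refl. Qed.
Lemma same_flat_class_sym : symmetric same_flat_class.
Proof. by move=> T T'; apply/asboolP/asboolP; apply: rst_sym. Qed.
Lemma same_flat_class_trans : transitive same_flat_class.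
Proof.
by move=> T T' T'' /asboolP h /asboolP h'; apply/asboolP; apply: rst_trans h h'.
Qed.
Canonical same_flat_class_equiv :=
  EquivRel same_flat_class same_flat_class_refl same_flat_class_sym same_flat_class_trans.

Definition flat_class := {eq_quot same_flat_class}.
Definition flat (T : tangle) : flat_class := \pi_flat_class T.

(* With the ascending direction (1, 1) and the descending one (1, -1), each   *)
(* multiplied by the orientation of its strand, the sign is that of           *)
(* det (over, under).                                                         *)
Definition sgn (s : slice) : int :=
  if s is Cross (Classical o) _ a b then (-1) ^+ (o (+) (a != b)) else 0.

(* The smoothing according to orientation: the two strands run alongside each *)
(* other if a = b, and turn back otherwise.                                   *)
Definition smooth_slice (s : slice) : seq slice :=
  if s is Cross _ h a b then (if a == b then [::] else [:: Cap h a; Cup h b]) else [:: s].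

Definition slice_at (D : seq slice) (d : 'I_(size D)) : slice := tnth (in_tuple D) d.
Definition crossing (D : seq slice) := {d : 'I_(size D) | is_classical (slice_at d)}.
Definition smoothing (D : seq slice) (d : 'I_(size D)) : seq slice :=
  take d D ++ smooth_slice (slice_at d) ++ drop d.+1 D.

Definition unlinked (D : seq slice) : seq slice := D ++ [:: Cup 1 true; Cap 1 true].

Section Components.
Local Open Scope nat_scope.
Implicit Types (w : seq bool) (R : rel nat) (s : slice) (D : seq slice).

(* Heights up to size w inclusive: the default value false at height size w   *)
(* plays the role of the initial end of the long component.                   *)
Local Notation o w := (nth false w).

Lemma stepP w s w' : step w s = Some w' ->
  exists u v, [/\ size u = height s, w = u ++ lhs s ++ v & w' = u ++ rhs s ++ v].
Proof.
rewrite /step; case: ifP => // /andP[le_h /eqP e] [<-].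
exists (take (height s) w), (drop (height s + size (lhs s)) w); split => //.
  by rewrite size_take_min; apply/minn_idPl.
rewrite -{1}(cat_take_drop (height s) w); congr (_ ++ _).
by rewrite addnC -drop_drop -{1}e cat_take_drop.
Qed.

Lemma step_Cross w k h a b w' : step w (Cross k h a b) = Some w' ->
  [/\ h.+1 < size w, size w' = size w, o w h = a, o w h.+1 = b &
      forall i, o w' i = o w (transp h h.+1 i)].
Proof.
move=> /stepP[u [v /= [su -> ->]]]; rewrite !size_cat /= su.
split; [lia | by [] | by rewrite nth_cat su ltnn subnn | | ].
  by rewrite nth_cat su ifF ?subSnn //; lia.
move=> i; rewrite /transp; case: (ltngtP i h) => [lt|gt|->].
- by rewrite ifF ?nth_cat ?su ?lt //; lia.
- case: eqVneq => [->|ne].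
    by rewrite !nth_cat su ltnn ifF ?subnn ?subSnn //; lia.
  rewrite !nth_cat su !ifF; try lia.
  by have -> : i - h = (i - h - 2).+2 by lia.
by rewrite !nth_cat su ltnn ifF ?subnn ?subSnn //; lia.
Qed.

Lemma step_Cap w h a w' : step w (Cap h a) = Some w' ->
  [/\ h.+1 < size w, (size w').+2 = size w, o w h.+1 = ~~ o w h &
      forall i, o w' i = o w (skip h i)].
Proof.
move=> /stepP[u [v /= [su -> ->]]]; rewrite !size_cat /= su.
split; [lia | lia | | ].
  by rewrite !nth_cat su ltnn subnn ifF ?subSnn //; lia.
move=> i; rewrite /skip !nth_cat su; case: ltnP => [->//|le].
by rewrite ifF; [have -> : i.+2 - h = (i - h).+2 by lia | lia].
Qed.

Lemma step_Cup w h a w' : step w (Cup h a) = Some w' ->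
  [/\ h <= size w, size w' = (size w).+2, o w' h = a, o w' h.+1 = ~~ a &
      forall i, i != h -> i != h.+1 -> o w' i = o w (unskip h i)].
Proof.
move=> /stepP[u [v /= [su -> ->]]]; rewrite !size_cat /= su.
split; [lia | lia | by rewrite nth_cat su ltnn subnn | | ].
  by rewrite !nth_cat su ifF ?subSnn //; lia.
move=> i ne ne1; rewrite /unskip !nth_cat su; case: ltnP => [->//|le].
rewrite ifF; last lia.
by have -> : i - h = (i.-2 - h).+2 by lia.
Qed.

Lemma transp_le p q n i : p <= n -> q <= n -> i <= n -> transp p q i <= n.
Proof. by rewrite /transp => *; do 2?case: ifP. Qed.

Lemma transpC p q i : transp p q i = transp q p i.
Proof. by rewrite /transp; do 2!case: eqVneq => // ->. Qed.

Lemma eq_join w s w' R R' : step w s = Some w' ->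
  (forall i j, i <= size w -> j <= size w -> R i j = R' i j) ->
  closes R s = closes R' s /\
  forall i j, i <= size w' -> j <= size w' -> join R s i j = join R' s i j.
Proof.
case: s => [k h a b|h a|h a] /= /[dup] st.
- move=> /step_Cross[lt ss _ _ _] e; split=> // i j; rewrite ss => li lj.
  by apply: e; apply: transp_le => //; lia.
- move=> /step_Cap[lt ss _ _] e; split; first by apply: e; lia.
  move=> i j li lj; have sk x : x <= size w' -> skip h x <= size w.
    by rewrite /skip; case: ifP; lia.
  have [lh lh1] : h <= size w /\ h.+1 <= size w by lia.
  by rewrite !e ?sk.
move=> /step_Cup[lt ss _ _ _] e; split=> // i j li lj.
by case: ifP => // _; apply: e; rewrite /unskip; case: ifP; lia.
Qed.

Lemma eq_closings D w w' R R' : run w D = Some w' ->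
  (forall i j, i <= size w -> j <= size w -> R i j = R' i j) ->
  closings R D = closings R' D.
Proof.
elim: D w R R' => //= s D IH w R R'; case st: (step w s) => [w1|] //= rD e.
have [-> e'] := eq_join st e.
by rewrite (IH _ _ _ rD e').
Qed.

(* Each strand is joined to exactly one other, of the opposite orientation.   *)
Record paired w R : Prop := Paired {
  pa_refl : forall i, i <= size w -> R i i;
  pa_sym : forall i j, i <= size w -> j <= size w -> R i j = R j i;
  pa_trans : forall i j k, i <= size w -> j <= size w -> k <= size w ->
    R i j -> R j k -> R i k;
  pa_opp : forall i j, i <= size w -> j <= size w -> R i j -> i != j -> o w i != o w j;
  pa_ex : forall i, i <= size w -> exists2 j, j <= size w & (j != i) && R i j }.

Lemma pa_row w R i j k : paired w R -> i <= size w -> j <= size w -> k <= size w ->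
  R i j -> i != j -> R i k = (k == i) || (k == j).
Proof.
move=> pR li lj lk Rij nij; case: eqVneq => [->|nki] /=; first exact: (pa_refl pR).
case: eqVneq => [->//|nkj]; apply/negP => Rik.
have := pa_opp pR li lj Rij nij; have := pa_opp pR li lk Rik.
rewrite eq_sym nki => /(_ isT).
have Rjk : R j k by apply: (pa_trans pR) Rik => //; rewrite (pa_sym pR).
have := pa_opp pR lj lk Rjk; rewrite eq_sym nkj => /(_ isT).
by case: (o w i) (o w j) (o w k) => [] [] [].
Qed.

Definition capR R c d : rel nat := fun x y => [|| R x y, R x c && R d y | R x d && R c y].
Lemma capRC R c d x y : capR R c d x y = capR R d c x y.
Proof. by rewrite /capR; congr (_ || _); rewrite orbC. Qed.

Definition cap_spec w R R' c d :=
  (R c d = R' c d /\ exists p q, [/\ p != q, p <= size w, q <= size w, o w p = o w q &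
     [/\ p != c, p != d, q != c, q != d &
      forall x y, x <= size w -> y <= size w -> x != c -> x != d -> y != c -> y != d ->
        capR R' c d x y = capR R c d (transp p q x) (transp p q y)]])
  \/ (R c d != R' c d /\
      forall x y, x <= size w -> y <= size w -> x != c -> x != d -> y != c -> y != d ->
        capR R' c d x y = capR R c d x y).

Lemma cap_specC w R R' c d : paired w R -> c <= size w -> d <= size w ->
  R' c d = R' d c -> cap_spec w R R' d c -> cap_spec w R R' c d.
Proof.
move=> pR lc ld sR' [[e [p [q [npq lp lq opq [pd pc qd qc H]]]]]|[e H]].
  left; split; first by rewrite (pa_sym pR) // e.
  exists p, q; split=> //; split=> // x y lx ly xc xd yc yd.
  by rewrite capRC H // capRC.
right; split; first by rewrite (pa_sym pR) // sR'.
by move=> x y lx ly xc xd yc yd; rewrite capRC H // capRC.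
Qed.

Lemma cap_spec0 w R R' c d p q : p != q -> p <= size w -> q <= size w ->
    o w p = o w q -> c <= size w -> d <= size w ->
    p != c -> p != d -> q != c -> q != d ->
  (forall i j, i <= size w -> j <= size w -> R' i j = R (transp p q i) (transp p q j)) ->
  cap_spec w R R' c d.
Proof.
move=> npq lp lq opq lc ld pc pd qc qd e.
have tc : transp p q c = c by rewrite /transp ![c == _]eq_sym (negPf pc) (negPf qc).
have td : transp p q d = d by rewrite /transp ![d == _]eq_sym (negPf pd) (negPf qd).
left; split; first by rewrite e // tc td.
exists p, q; split=> //; split=> // x y lx ly xc xd yc yd.
by rewrite /capR !e // tc td.
Qed.

Lemma cap_spec1 w R R' (c d q : nat) : paired w R -> c != d -> q != c -> q != d ->
    q <= size w -> c <= size w -> d <= size w -> o w c = o w q ->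
  (forall i j, i <= size w -> j <= size w -> R' i j = R (transp c q i) (transp c q j)) ->
  cap_spec w R R' c d.
Proof.
move=> pR ncd qc qd lq lc ld ocq e.
have tc : transp c q c = q by rewrite /transp eqxx.
have td : transp c q d = d by rewrite /transp ![d == _]eq_sym (negPf ncd) (negPf qd).
have tE x : x != c -> transp c q x = if x == q then c else x.
  by rewrite /transp => /negPf->.
have R'cd : R' c d = R q d by rewrite e // tc td.
have ncq : R c q = false.
  by apply: contraTF isT => Rcq; have := pa_opp pR lc lq Rcq; rewrite eq_sym qc ocq eqxx => /(_ isT).
have nqc : R q c = false by rewrite (pa_sym pR).
have capE x y : x <= size w -> y <= size w -> x != c -> x != d -> y != c -> y != d ->
    capR R' c d x y = [|| R (if x == q then c else x) (if y == q then c else y),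
      R (if x == q then c else x) q && R d (if y == q then c else y)
    | R (if x == q then c else x) d && R q (if y == q then c else y)].
  by move=> lx ly xc xd yc yd; rewrite /capR !e // tc td !tE.
case Rcd: (R c d).
  have rc k : k <= size w -> R c k = (k == c) || (k == d).
    by move=> lk; apply: (pa_row pR) Rcd ncd.
  have Rdc : R d c by rewrite (pa_sym pR).
  have ndc : d != c by rewrite eq_sym.
  have rd k : k <= size w -> R d k = (k == d) || (k == c).
    by move=> lk; apply: (pa_row pR) Rdc ndc.
  have Rqd : R q d = false by rewrite (pa_sym pR) // rd // (negPf qd) (negPf qc).
  right; split; first by rewrite R'cd Rcd Rqd.
  move=> x y lx ly xc xd yc yd; rewrite capE // /capR.
  have f z : z <= size w -> z != c -> z != d ->
      [/\ R c z = false, R z c = false, R d z = false & R z d = false].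
    move=> lz zc zd; rewrite ![R z _](pa_sym pR) //.
    by rewrite rc // rd // (negPf zc) (negPf zd).
  have [cx xc' dx xd'] := f _ lx xc xd; have [cy yc' dy yd'] := f _ ly yc yd.
  move: cx xc' dx xd' cy yc' dy yd'.
  case: (eqVneq x q) => [->|nx]; case: (eqVneq y q) => [->|ny];
  by move=> *; rewrite ?(pa_refl pR) //; do ?(match goal with H : _ = false |- _ => rewrite H end); rewrite ?Rcd ?Rdc ?andbF ?andbT ?orbF.
case Rqd: (R q d).
  have rq k : k <= size w -> R q k = (k == q) || (k == d).
    by move=> lk; apply: (pa_row pR) Rqd qd.
  have Rdq : R d q by rewrite (pa_sym pR).
  have ndq : d != q by rewrite eq_sym.
  have rd k : k <= size w -> R d k = (k == d) || (k == q).
    by move=> lk; apply: (pa_row pR) Rdq ndq.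
  right; split; first by rewrite R'cd Rcd Rqd.
  move=> x y lx ly xc xd yc yd; rewrite capE // /capR.
  have f z : z <= size w -> z != q -> z != d ->
      [/\ R q z = false, R z q = false, R d z = false & R z d = false].
    move=> lz zq zd; rewrite ![R z _](pa_sym pR) //.
    by rewrite rq // rd // (negPf zq) (negPf zd).
  case: (eqVneq x q) => [->|nx]; case: (eqVneq y q) => [->|ny].
  - by rewrite !(pa_refl pR).
  - have [f1 f2 f3 f4] := f _ ly ny yd.
    by rewrite f1 f3 Rqd Rcd ncq !andbF !orbF.
  - have [f1 f2 f3 f4] := f _ lx nx xd.
    by rewrite f2 f4 nqc Rdq andbT andbF !orbF.
  have [f1 f2 f3 f4] := f _ ly ny yd; have [f5 f6 f7 f8] := f _ lx nx xd.
  by rewrite f1 f3 f6 f8 !andbF.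
have [s ls /andP[nsc Rcs]] := pa_ex pR lc.
have [r lr /andP[nrq Rqr]] := pa_ex pR lq.
have ncs : c != s by rewrite eq_sym.
have nqr : q != r by rewrite eq_sym.
have Rsc : R s c by rewrite (pa_sym pR).
have Rrq : R r q by rewrite (pa_sym pR).
have rc k : k <= size w -> R c k = (k == c) || (k == s) by move=> lk; apply: (pa_row pR) Rcs ncs.
have rq k : k <= size w -> R q k = (k == q) || (k == r) by move=> lk; apply: (pa_row pR) Rqr nqr.
have rs k : k <= size w -> R s k = (k == s) || (k == c) by move=> lk; apply: (pa_row pR) Rsc nsc.
have rr k : k <= size w -> R r k = (k == r) || (k == q) by move=> lk; apply: (pa_row pR) Rrq nrq.
have nsd : s != d by apply: contraFneq Rcd => <-.
have nrd : r != d by apply: contraFneq Rqd => <-.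
have nrc : r != c by apply: contraFneq nqc => <-.
have nsq : s != q by apply: contraFneq ncq => <-.
have nsr : s != r.
  apply: contraNneq nrq => E; have := rs _ lq.
  by rewrite {1}E Rrq (negPf qc) orbF => /esym/eqP->; rewrite E.
have osr : o w s = o w r.
  have := pa_opp pR lc ls Rcs ncs; have := pa_opp pR lq lr Rqr nqr; rewrite ocq.
  by case: (o w q) (o w s) (o w r) => [] [] [].
apply: (cap_spec0 nsr ls lr osr) => // i j li lj; rewrite e //.
have cls x : x = c \/ x = q \/ x = s \/ x = r \/ [&& x != c, x != q, x != s & x != r].
  case: (x =P c) => [|_]; first by left.
  case: (x =P q) => [|_]; first by right; left.
  case: (x =P s) => [|_]; first by right; right; left.
  by case: (x =P r) => [|_]; right; right; right; [left | right].
have H : (c == q = false) * (c == s = false) * (c == r = false) * (q == c = false)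
  * (q == s = false) * (q == r = false) * (s == c = false) * (s == q = false)
  * (s == r = false) * (r == c = false) * (r == q = false) * (r == s = false).
  by do !split; apply/negP => /eqP E; subst; rewrite ?eqxx in qc nrq nsc nsq nsr nrc.
case: (cls i) => [->|[->|[->|[->|/and4P[/negPf i1 /negPf i2 /negPf i3 /negPf i4]]]]];
case: (cls j) => [->|[->|[->|[->|/and4P[/negPf j1 /negPf j2 /negPf j3 /negPf j4]]]]];
rewrite /transp ?eqxx ?H ?i1 ?i2 ?i3 ?i4 ?j1 ?j2 ?j3 ?j4 //;
rewrite ?(pa_refl pR) //;
rewrite ?rc ?rq ?rs ?rr ?eqxx ?H ?i1 ?i2 ?i3 ?i4 ?j1 ?j2 ?j3 ?j4 ?orbT //;
by rewrite (pa_sym pR) // ?rc ?rq ?rs ?rr // ?i1 ?i2 ?i3 ?i4 (pa_sym pR) // ?rc ?rq ?rs ?rr // ?i1 ?i2 ?i3 ?i4.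
Qed.

Lemma cap_specP w R R' c d p q : paired w R -> c != d -> p != q ->
    p <= size w -> q <= size w -> c <= size w -> d <= size w ->
    o w p = o w q -> o w c != o w d ->
  (forall i j, i <= size w -> j <= size w -> R' i j = R (transp p q i) (transp p q j)) ->
  cap_spec w R R' c d.
Proof.
move=> pR ncd npq lp lq lc ld opq ocd e.
have sym' : R' c d = R' d c by rewrite !e // (pa_sym pR) // transp_le.
have e' i j : i <= size w -> j <= size w -> R' i j = R (transp q p i) (transp q p j).
  by move=> li lj; rewrite e // ![transp q p _]transpC.
have ndc : d != c by rewrite eq_sym.
case: (eqVneq p c) => [E|pc].
  subst p; apply: (cap_spec1 (q := q)) e => //; first by rewrite eq_sym.
  by apply: contraNneq ocd => <-; apply/eqP.
case: (eqVneq p d) => [E|pd].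
  subst p; apply: cap_specC => //; apply: (cap_spec1 (q := q)) e => //; first by rewrite eq_sym.
  by apply: contraNneq ocd => <-; apply/eqP.
case: (eqVneq q c) => [E|qc].
  by subst q; apply: (cap_spec1 (q := p)) e'.
case: (eqVneq q d) => [E|qd].
  by subst q; apply: cap_specC => //; apply: (cap_spec1 (q := p)) e'.
exact: cap_spec0 e.
Qed.

Lemma transpK p q i : transp p q (transp p q i) = i.
Proof. by rewrite /transp; case: (eqVneq i p) => [->|a]; rewrite ?eqxx; [case: eqVneq|case: (eqVneq i q) => [->|b]; rewrite ?eqxx // (negPf a) (negPf b)]. Qed.
Lemma transp_inj p q i j : transp p q i = transp p q j -> i = j.
Proof. by move=> e; rewrite -(transpK p q i) e transpK. Qed.
Lemma skip_inj h i j : skip h i = skip h j -> i = j.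
Proof. by rewrite /skip; case: (ltnP i h); case: (ltnP j h); lia. Qed.
Lemma skipK h i : unskip h (skip h i) = i.
Proof. by rewrite /skip /unskip; case: (ltnP i h) => [->//|l]; rewrite ifF //; lia. Qed.
Lemma unskipK h i : i != h -> i != h.+1 -> skip h (unskip h i) = i.
Proof.
by move=> n1 n2; rewrite /skip /unskip; case: (ltnP i h) => [->//|l]; rewrite ifF; lia.
Qed.
Lemma paired_step w s w' R : step w s = Some w' -> paired w R -> paired w' (join R s).
Proof.
case: s => [k h a b|h a|h a] st pR.
- have [lt ss _ _ oE] := step_Cross st.
  have tl i : i <= size w' -> transp h h.+1 i <= size w.
    by rewrite ss => li; apply: transp_le => //; lia.
  split=> /=.
  + by move=> i li; apply: (pa_refl pR); apply: tl.
  + by move=> i j li lj; apply: (pa_sym pR); apply: tl.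
  + by move=> i j l li lj ll; apply: (pa_trans pR); apply: tl.
  + move=> i j li lj Rij nij; rewrite !oE; apply: (pa_opp pR) => //; try exact: tl.
    by apply: contra_neq nij => /transp_inj.
  move=> i li; have [j lj /andP[nij Rij]] := pa_ex pR (tl _ li).
  exists (transp h h.+1 j); first by rewrite ss; apply: transp_le => //; lia.
  by rewrite transpK Rij andbT; apply: contra_neq nij => <-; rewrite transpK.
- have [lt ss oh oE] := step_Cap st.
  have lh : h <= size w by lia.
  have lh1 : h.+1 <= size w by lia.
  have tl i : i <= size w' -> skip h i <= size w by rewrite /skip; case: ltnP; lia.
  have sh i : skip h i != h by rewrite /skip; case: ltnP; lia.
  have sh1 i : skip h i != h.+1 by rewrite /skip; case: ltnP; lia.
  have nh : h != h.+1 by lia.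
  have sP x : x <= size w -> x != h -> x != h.+1 -> exists2 i, i <= size w' & x = skip h i.
    move=> lx nx nx1; exists (unskip h x); last by rewrite unskipK.
    by rewrite /unskip; case: ltnP; lia.
  case Rh: (R h h.+1).
    have rh k : k <= size w -> R h k = (k == h) || (k == h.+1) by move=> lk; apply: (pa_row pR) Rh nh.
    have rh1 k : k <= size w -> R h.+1 k = (k == h.+1) || (k == h).
      move=> lk; apply: (pa_row pR) => //; last by rewrite eq_sym.
      by rewrite (pa_sym pR).
    have jE i j : i <= size w' -> j <= size w' -> join R (Cap h a) i j = R (skip h i) (skip h j).
      move=> li lj /=; rewrite rh ?tl // rh1 ?tl //.
      by rewrite (negPf (sh j)) (negPf (sh1 j)) /= !andbF !orbF.
    split.
    + by move=> i li; rewrite jE //; apply: (pa_refl pR); apply: tl.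
    + by move=> i j li lj; rewrite !jE //; apply: (pa_sym pR); apply: tl.
    + by move=> i j l li lj ll; rewrite !jE //; apply: (pa_trans pR); apply: tl.
    + move=> i j li lj; rewrite jE // => Rij nij; rewrite !oE; apply: (pa_opp pR) => //; try exact: tl.
      by apply: contra_neq nij => /skip_inj.
    move=> i li; have [x lx /andP[nxi Rx]] := pa_ex pR (tl _ li).
    have nx : x != h.
      by apply: contraTneq Rx => ->; rewrite (pa_sym pR) ?tl // rh ?tl // (negPf (sh _)) (negPf (sh1 _)).
    have nx1 : x != h.+1.
      by apply: contraTneq Rx => ->; rewrite (pa_sym pR) ?tl // rh1 ?tl // (negPf (sh _)) (negPf (sh1 _)).
    have [j lj E] := sP _ lx nx nx1; exists j => //.
    by rewrite jE // -E Rx andbT; apply: contra_neq nxi => <-.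
  have [s ls /andP[nsh Rhs]] := pa_ex pR lh.
  have [r lr /andP[nrh Rhr]] := pa_ex pR lh1.
  have nhs : h != s by rewrite eq_sym.
  have nhr : h.+1 != r by rewrite eq_sym.
  have Rh1 : R h.+1 h = false by rewrite (pa_sym pR).
  have nsh1 : s != h.+1 by apply: contraFneq Rh => <-.
  have nrh0 : r != h by apply: contraFneq Rh1 => E; rewrite -{2}E.
  have Rsh : R s h by rewrite (pa_sym pR).
  have Rrh : R r h.+1 by rewrite (pa_sym pR).
  have rh k : k <= size w -> R h k = (k == h) || (k == s) by move=> lk; apply: (pa_row pR) Rhs nhs.
  have rh1 k : k <= size w -> R h.+1 k = (k == h.+1) || (k == r) by move=> lk; apply: (pa_row pR) Rhr nhr.
  have rs k : k <= size w -> R s k = (k == s) || (k == h) by move=> lk; apply: (pa_row pR) Rsh nsh.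
  have rr k : k <= size w -> R r k = (k == r) || (k == h.+1) by move=> lk; apply: (pa_row pR) Rrh nrh.
  have nsr : s != r.
    by apply: contraTneq Rsh => ->; rewrite rr // eq_sym (negPf nrh0) (negPf nh).
  have jE i j : i <= size w' -> j <= size w' -> join R (Cap h a) i j =
      [|| R (skip h i) (skip h j), (skip h i == s) && (skip h j == r)
        | (skip h i == r) && (skip h j == s)].
    move=> li lj /=; rewrite ![R _ h](pa_sym pR) ?tl // ![R _ h.+1](pa_sym pR) ?tl //.
    rewrite !rh ?tl // !rh1 ?tl //.
    by rewrite (negPf (sh i)) (negPf (sh1 i)) (negPf (sh j)) (negPf (sh1 j)).
  have osr : o w s != o w r.
    have := pa_opp pR lh ls Rhs nhs; have := pa_opp pR lh1 lr Rhr nhr; rewrite oh.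
    by case: (o w h) (o w s) (o w r) => [] [] [].
  split.
  + by move=> i li; rewrite jE // (pa_refl pR) ?tl.
  + move=> i j li lj; rewrite !jE // (pa_sym pR) ?tl //; congr (_ || _).
    by rewrite orbC; congr (_ || _); rewrite andbC.
  + move=> i j l li lj ll; rewrite !jE //.
    have S1 x : x <= size w' -> R s (skip h x) = (skip h x == s).
      by move=> lx; rewrite rs ?tl // (negPf (sh x)) orbF.
    have S2 x : x <= size w' -> R r (skip h x) = (skip h x == r).
      by move=> lx; rewrite rr ?tl // (negPf (sh1 x)) orbF.
    case/or3P=> [Rij|/andP[/eqP e1 /eqP e2]|/andP[/eqP e1 /eqP e2]].
    * case/or3P=> [Rjl|/andP[/eqP e1 /eqP e2]|/andP[/eqP e1 /eqP e2]].
      - by rewrite (pa_trans pR (tl _ li) (tl _ lj) (tl _ ll) Rij Rjl).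
      - by move: Rij; rewrite e1 (pa_sym pR) ?tl // S1 // => ->; rewrite e2 eqxx orbT.
      - by move: Rij; rewrite e1 (pa_sym pR) ?tl // S2 // => ->; rewrite e2 eqxx !orbT.
    * by rewrite e1 e2 S1 // S2 // !eqxx [r == s]eq_sym (negPf nsr) /= ?orbF orbC.
    * by rewrite e1 e2 S1 // S2 // !eqxx [r == s]eq_sym (negPf nsr) /= ?orbF orbC.
  + move=> i j li lj; rewrite jE // !oE => Rij nij.
    case/or3P: Rij => [Rij|/andP[/eqP -> /eqP ->]|/andP[/eqP -> /eqP ->]] //.
      apply: (pa_opp pR) => //; try exact: tl.
      by apply: contra_neq nij => /skip_inj.
    by rewrite eq_sym.
  move=> i li.
  case: (eqVneq (skip h i) s) => [E|nis].
    have [j lj Ej] := sP _ lr nrh0 nrh; exists j => //.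
    rewrite jE // E -Ej !eqxx orbT andbT; apply: contraNneq nsr => Eji.
    by rewrite Ej Eji E.
  case: (eqVneq (skip h i) r) => [E|nir].
    have [j lj Ej] := sP _ ls nsh nsh1; exists j => //.
    rewrite jE // E -Ej !eqxx !orbT andbT; apply: contraNneq nsr => Eji.
    by rewrite Ej Eji E.
  have [x lx /andP[nxi Rx]] := pa_ex pR (tl _ li).
  have nx : x != h.
    by apply: contraTneq Rx => ->; rewrite (pa_sym pR) ?tl // rh ?tl // (negPf (sh _)) (negPf nis).
  have nx1 : x != h.+1.
    by apply: contraTneq Rx => ->; rewrite (pa_sym pR) ?tl // rh1 ?tl // (negPf (sh1 _)) (negPf nir).
  have [j lj E] := sP _ lx nx nx1; exists j => //.
  by rewrite jE // -E Rx andbT; apply: contra_neq nxi => <-.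
have [lt ss oh oh1 oE] := step_Cup st.
have tl i : i <= size w' -> i != h -> i != h.+1 -> unskip h i <= size w.
  by rewrite /unskip; case: ltnP; lia.
pose new x := (x == h) || (x == h.+1).
have jE i j : join R (Cup h a) i j = if new i || new j then new i && new j else R (unskip h i) (unskip h j).
  by [].
have nE x : new x = false -> x != h /\ x != h.+1 by move/negbT; rewrite negb_or => /andP.
have ul x : x <= size w' -> new x = false -> unskip h x <= size w.
  by move=> lx /nE[n1 n2]; apply: tl.
split.
- by move=> i li; rewrite jE orbb andbb; case E: (new i) => //; apply: (pa_refl pR); apply: ul.
- move=> i j li lj; rewrite !jE; case Ei: (new i); case Ej: (new j) => //=.
  by apply: (pa_sym pR); apply: ul.
- move=> i j l li lj ll; rewrite !jE.
  case Ei: (new i); case Ej: (new j); case El: (new l) => //=.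
  by apply: (pa_trans pR); apply: ul.
- move=> i j li lj; rewrite jE.
  case Ei: (new i); case Ej: (new j) => //=.
    move=> _; case/orP: Ei => /eqP->; case/orP: Ej => /eqP->; rewrite ?eqxx // oh oh1 => _; by case: (a).
  move=> Rij nij; have [i1 i2] := nE _ Ei; have [j1 j2] := nE _ Ej; rewrite !oE //.
  apply: (pa_opp pR) => //; try exact: ul.
  by apply: contra_neq nij => E; rewrite -(unskipK i1 i2) E unskipK.
move=> i li; case Ei: (new i).
  case/orP: Ei => /eqP->; [exists h.+1|exists h]; try lia;
  by rewrite jE /new !eqxx ?orbT /= andbT; lia.
have [x lx /andP[nx Rx]] := pa_ex pR (ul _ li Ei).
exists (skip h x); first by rewrite ss /skip; case: ltnP; lia.
have nn : new (skip h x) = false by rewrite /new /skip; case: ltnP; lia.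
rewrite jE Ei nn /= skipK Rx andbT; apply: contra_neq nx => <-; by rewrite skipK.
Qed.

Lemma closings_transp D w R R' p q : run w D = Some [:: true] -> paired w R ->
    p != q -> p <= size w -> q <= size w -> o w p = o w q ->
  (forall i j, i <= size w -> j <= size w -> R' i j = R (transp p q i) (transp p q j)) ->
  closings R' D = (closings R D).+1 \/ closings R D = (closings R' D).+1.
Proof.
elim: D w R R' p q => [|s D IH] w R R' p q /=.
  by case=> -> _; case: p q => [|[|p]] [|[|q]].
case st: (step w s) => [w'|] //= rD pR npq lp lq opq e.
have pR' := paired_step st pR.
case: s st pR' => [k h a b|h a|h a] st pR'.
- have [lt ss _ _ oE] := step_Cross st.
  have tl i : i <= size w -> transp h h.+1 i <= size w'.
    by rewrite ss => li; apply: transp_le => //; lia.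
  apply: (IH w' _ _ (transp h h.+1 p) (transp h h.+1 q)) => //=; try exact: tl.
  + by apply: contra_neq npq => /transp_inj.
  + by rewrite !oE !transpK.
  move=> i j li lj; rewrite e; try by rewrite -ss; apply: transp_le => //; lia.
  have tt x : transp p q (transp h h.+1 x) =
    transp h h.+1 (transp (transp h h.+1 p) (transp h h.+1 q) x).
    have inv y : (x == transp h h.+1 y) = (transp h h.+1 x == y).
      by apply/eqP/eqP => [->|<-]; rewrite transpK.
    by rewrite {1 4}/transp !inv; case: eqP => _; [rewrite transpK | case: eqP => _; rewrite ?transpK].
  by rewrite !tt.
- have [lt ss oh oE] := step_Cap st.
  have lh : h <= size w by lia.
  have lh1 : h.+1 <= size w by lia.
  have ocd : o w h != o w h.+1 by rewrite oh; case: (o w h).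
  have ncd : h != h.+1 by lia.
  have tl i : i <= size w' -> skip h i <= size w by rewrite /skip; case: ltnP; lia.
  have sh i : skip h i != h by rewrite /skip; case: ltnP; lia.
  have sh1 i : skip h i != h.+1 by rewrite /skip; case: ltnP; lia.
  case: (cap_specP pR ncd npq lp lq lh lh1 opq ocd e) => [[E [p2 [q2 [npq2 lp2 lq2 opq2 [p2h p2h1 q2h q2h1 H]]]]]|[E H]].
    have ul x : x <= size w -> x != h -> x != h.+1 -> unskip h x <= size w'.
      by rewrite /unskip; case: ltnP; lia.
    have := IH w' (join R (Cap h a)) (join R' (Cap h a)) (unskip h p2) (unskip h q2) rD pR'.
    rewrite !oE !unskipK //.
    have hn : unskip h p2 != unskip h q2.
      by apply: contra_neq npq2 => E2; rewrite -(unskipK p2h p2h1) E2 unskipK.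
    move=> /(_ hn (ul _ lp2 p2h p2h1) (ul _ lq2 q2h q2h1) opq2).
    have ht : forall i j, i <= size w' -> j <= size w' -> join R' (Cap h a) i j =
       join R (Cap h a) (transp (unskip h p2) (unskip h q2) i) (transp (unskip h p2) (unskip h q2) j).
      move=> i j li lj; have := H _ _ (tl _ li) (tl _ lj) (sh i) (sh1 i) (sh j) (sh1 j).
      have tt x : transp p2 q2 (skip h x) = skip h (transp (unskip h p2) (unskip h q2) x).
        have inv y : y != h -> y != h.+1 -> (x == unskip h y) = (skip h x == y).
          by move=> y1 y2; apply/eqP/eqP => [->|<-]; rewrite ?unskipK ?skipK.
        by rewrite /transp !inv //; case: eqP => _; [rewrite unskipK | case: eqP => _; rewrite ?unskipK].
      by rewrite !tt.
    move=> /(_ ht) /=; rewrite E.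
    by case=> ->; [left | right]; rewrite addnS.
  have -> : closings (join R' (Cap h a)) D = closings (join R (Cap h a)) D.
    apply: eq_closings rD _ => i j li lj.
    exact: H (tl _ li) (tl _ lj) (sh i) (sh1 i) (sh j) (sh1 j).
  by move: E => /=; case: (R h h.+1); case: (R' h h.+1) => // _; [right | left].
have [lt ss oh oh1 oE] := step_Cup st.
have sl i : i <= size w -> skip h i <= size w' by rewrite /skip; case: ltnP; lia.
have sh i : skip h i != h by rewrite /skip; case: ltnP; lia.
have sh1 i : skip h i != h.+1 by rewrite /skip; case: ltnP; lia.
apply: (IH w' _ _ (skip h p) (skip h q)) => //; try exact: sl.
- by apply: contra_neq npq => /skip_inj.
- by rewrite !oE // !skipK.
move=> i j li lj /=.
have inv x y : y = x \/ y <> x -> (x == skip h y) = ~~ ((x == h) || (x == h.+1)) && (unskip h x == y).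
  move=> _; apply/eqP/idP => [->|/andP[]].
    by rewrite negb_or sh sh1 skipK eqxx.
  by rewrite negb_or => /andP[x1 x2] /eqP<-; rewrite unskipK.
have tt x : let y := transp (skip h p) (skip h q) x in
    ((y == h) || (y == h.+1) = (x == h) || (x == h.+1)) /\
    (~~ ((x == h) || (x == h.+1)) -> unskip h y = transp p q (unskip h x)).
  rewrite /= /transp; case: (eqVneq x (skip h p)) => [->|np].
    by rewrite (negPf (sh _)) (negPf (sh1 _)) (negPf (sh _)) (negPf (sh1 _)) !skipK eqxx.
  case: (eqVneq x (skip h q)) => [->|nq].
    rewrite (negPf (sh _)) (negPf (sh1 _)) (negPf (sh _)) (negPf (sh1 _)) !skipK eqxx; split=> // _.
    by rewrite ifF //; apply/negbTE; rewrite eq_sym.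
  split=> //; rewrite negb_or => /andP[x1 x2].
  rewrite !ifF //; apply/eqP => E; [move: nq | move: np]; by rewrite -E unskipK ?eqxx.
have [-> ui] := tt i; have [-> uj] := tt j.
case: ifP => // /negbT; rewrite negb_or => /andP[ni nj].
rewrite ui // uj // e //; move: ni nj; rewrite /unskip; do 2!case: ltnP; lia.
Qed.

Lemma run_cat w D D' : run w (D ++ D') = obind (run^~ D') (run w D).
Proof. by elim: D w => //= s D IH w; case: (step w s). Qed.

Lemma closings_cat R D D' :
  closings R (D ++ D') = closings R D + closings (foldl join R D) D'.
Proof. by elim: D R => //= s D IH R; rewrite IH addnA. Qed.

Lemma paired_run D w w' R : run w D = Some w' -> paired w R -> paired w' (foldl join R D).
Proof.
elim: D w R => [|s D IH] w R /=; first by case=> <-.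
by case st: (step w s) => [w1|] //= rD pR; apply: IH rD (paired_step st pR).
Qed.

Lemma paired_start : paired [:: true] (fun _ _ => true).
Proof.
split=> //; first by case=> [|[|i]] [|[|j]].
by case=> [|[|i]] //; [exists 1 | exists 0].
Qed.

Lemma step_smooth w w' k h a b : step w (Cross k h a b) = Some w' ->
  run w (smooth_slice (Cross k h a b)) = Some w'.
Proof.
move=> /stepP[u [v /= [su -> ->]]]; case: eqVneq => [->//|nab] /=.
have -> : b = ~~ a by move: nab; case: (a) (b) => [] [].
rewrite /step /= size_cat /= -su leq_addr drop_size_cat //= !take0 eqxx /=.
rewrite take_size_cat // addnC -drop_drop drop_size_cat //= drop0 size_cat leq_addr /=.
by rewrite take0 eqxx /= addn0 take_size_cat // drop_size_cat // negbK.
Qed.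

Lemma closings_smooth w w' k h a b R D : step w (Cross k h a b) = Some w' ->
    run w' D = Some [:: true] -> paired w R ->
  closings R (Cross k h a b :: D) = 0 -> closings R (smooth_slice (Cross k h a b) ++ D) = 1.
Proof.
move=> st rD pR /=; have [lt ss oa ob oE] := step_Cross st.
have pR' := paired_step st pR.
rewrite add0n => c0.
have one R' p q : p != q -> p <= size w' -> q <= size w' -> o w' p = o w' q ->
    (forall i j, i <= size w' -> j <= size w' ->
      R' i j = join R (Cross k h a b) (transp p q i) (transp p q j)) ->
    closings R' D = 1.
  move=> npq lp lq opq e; have := closings_transp rD pR' npq lp lq opq e.
  by rewrite /= c0 => -[].
have lh : h <= size w by lia.
have lh1 : h.+1 <= size w by lia.
have nh : h != h.+1 by lia.
have th : transp h h.+1 h = h.+1 by rewrite /transp eqxx.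
have th1 : transp h h.+1 h.+1 = h by rewrite /transp eqxx ifF //; lia.
case: eqVneq => [ab|nab] /=.
  apply: (one _ h h.+1); rewrite ?ss //; first by rewrite !oE th th1 oa ob.
  by move=> i j _ _ /=; rewrite !transpK.
have tE x : x != h -> x != h.+1 -> transp h h.+1 x = x.
  by rewrite /transp => /negPf-> /negPf->.
pose R2 : rel nat := join (join R (Cap h a)) (Cup h b).
rewrite -/R2.
have R2E x y : R2 x y = if ((x == h) || (x == h.+1)) || ((y == h) || (y == h.+1))
    then ((x == h) || (x == h.+1)) && ((y == h) || (y == h.+1))
    else [|| R x y, R x h && R h.+1 y | R x h.+1 && R h y].
  rewrite /R2 /=; case: ifP => // /negbT; rewrite !negb_or => /andP[/andP[x1 x2] /andP[y1 y2]].
  by rewrite !unskipK.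
case Rh: (R h h.+1).
  have rh z : z <= size w -> R h z = (z == h) || (z == h.+1) by move=> lz; apply: (pa_row pR) Rh nh.
  have Rh1 : R h.+1 h by rewrite (pa_sym pR).
  have nh1 : h.+1 != h by rewrite eq_sym.
  have rh1 z : z <= size w -> R h.+1 z = (z == h.+1) || (z == h).
    by move=> lz; apply: (pa_row pR) Rh1 nh1.
  suff -> : closings R2 D = closings (join R (Cross k h a b)) D by rewrite [closings _ D]c0.
  apply: eq_closings rD _ => x y; rewrite ss => lx ly; rewrite R2E /=.
  case: (eqVneq x h) => [->|x1]; [|case: (eqVneq x h.+1) => [->|x2]];
  case: (eqVneq y h) => [->|y1]; rewrite ?th ?th1;
  try (case: (eqVneq y h.+1) => [->|y2]); rewrite ?th ?th1 ?tE //= ?(pa_refl pR) ?Rh //.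
  - by rewrite rh1 // (negPf y1) (negPf y2).
  - by rewrite rh // (negPf y1) (negPf y2).
  - by rewrite (pa_sym pR) // rh1 // (negPf x1) (negPf x2).
  - by rewrite (pa_sym pR) // rh // (negPf x1) (negPf x2).
  by rewrite rh // rh1 // (negPf y1) (negPf y2) !andbF !orbF.
have [s ls /andP[nsh Rhs]] := pa_ex pR lh.
have [r lr /andP[nrh Rhr]] := pa_ex pR lh1.
have nhs : h != s by rewrite eq_sym.
have nhr : h.+1 != r by rewrite eq_sym.
have Rh1 : R h.+1 h = false by rewrite (pa_sym pR).
have nsh1 : s != h.+1 by apply: contraFneq Rh => <-.
have nrh0 : r != h by apply: contraFneq Rh1 => E; rewrite -{2}E.
have Rsh : R s h by rewrite (pa_sym pR).
have Rrh : R r h.+1 by rewrite (pa_sym pR).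
have rh z : z <= size w -> R h z = (z == h) || (z == s) by move=> lz; apply: (pa_row pR) Rhs nhs.
have rh1 z : z <= size w -> R h.+1 z = (z == h.+1) || (z == r) by move=> lz; apply: (pa_row pR) Rhr nhr.
have rs z : z <= size w -> R s z = (z == s) || (z == h) by move=> lz; apply: (pa_row pR) Rsh nsh.
have rr z : z <= size w -> R r z = (z == r) || (z == h.+1) by move=> lz; apply: (pa_row pR) Rrh nrh.
have nsr : s != r.
  by apply: contraTneq Rsh => ->; rewrite rr // eq_sym (negPf nrh0) (negPf nh).
apply: (one _ h s); rewrite ?ss //.
  rewrite !oE th tE // ob; have := pa_opp pR lh ls Rhs nhs; rewrite oa.
  by move: nab; case: (a) (b) (o w s) => [] [] [].
move=> x y lx ly; rewrite R2E /=.
have H : (h == h.+1 = false) * (h.+1 == h = false) * (s == h = false) * (s == h.+1 = false)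
   * (h == s = false) * (h.+1 == s = false) * (r == h = false) * (r == h.+1 = false)
   * (h == r = false) * (h.+1 == r = false) * (s == r = false) * (r == s = false).
  by do !split; apply/negbTE => //; rewrite eq_sym.
have cls z : z = h \/ z = h.+1 \/ z = s \/ z = r \/ [&& z != h, z != h.+1, z != s & z != r].
  case: (z =P h) => [|_]; first by left.
  case: (z =P h.+1) => [|_]; first by right; left.
  case: (z =P s) => [|_]; first by right; right; left.
  by case: (z =P r) => [|_]; right; right; right; [left | right].
rewrite ![R x h](pa_sym pR) ?[R x h.+1](pa_sym pR) //.
case: (cls x) lx => [->|[->|[->|[->|/and4P[/negPf i1 /negPf i2 /negPf i3 /negPf i4]]]]] lx;
case: (cls y) ly => [->|[->|[->|[->|/and4P[/negPf j1 /negPf j2 /negPf j3 /negPf j4]]]]] ly;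
rewrite /transp ?eqxx ?H ?i1 ?i2 ?i3 ?i4 ?j1 ?j2 ?j3 ?j4 /= ?eqxx ?H ?i1 ?i2 ?i3 ?i4 ?j1 ?j2 ?j3 ?j4 /=
  ?(pa_refl pR) //;
rewrite ?rh ?rh1 ?rs ?rr // ?eqxx ?H ?i1 ?i2 ?i3 ?i4 ?j1 ?j2 ?j3 ?j4 ?orbT ?andbF ?orbF //;
try by rewrite (pa_sym pR) // ?rh ?rh1 ?rs ?rr // ?i1 ?i2 ?i3 ?i4.
by rewrite ![R x _](pa_sym pR) // rs // rh1 // i1 i2 i3 i4.
Qed.

Lemma is_tangle_smoothing D (d : 'I_(size D)) : is_long_knot D -> is_classical (slice_at d) ->
  is_tangle (smoothing d).
Proof.
rewrite /is_long_knot /is_singular_knot /smoothing => /andP[/andP[/eqP rD /eqP cD]].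
have E : D = take d D ++ slice_at d :: drop d.+1 D.
  by rewrite /slice_at (tnth_nth (Cup 0 true)) -drop_nth // cat_take_drop.
move: rD cD; rewrite /closed_components /doubles {1 2 3}E.
set u := take d D; set v := drop d.+1 D.
case: (slice_at d) => // k h a b rD cD dD cl.
have {dD} /andP[/eqP du /eqP dv] : (count is_double u == 0) && (count is_double v == 0).
  by move: dD; rewrite count_cat /=; case: (k) cl => //=; lia.
move: rD; rewrite run_cat; case ru: (run _ u) => [w|] //=.
case st: (step w _) => [w'|] //= rv.
have pR := paired_run ru paired_start.
move: cD; rewrite closings_cat => /eqP; rewrite addn_eq0 => /andP[/eqP cu /eqP cv].
rewrite /is_tangle /valid /closed_components /doubles.
apply/and3P; split.
- by rewrite !run_cat ru /= run_cat (step_smooth st) /= rv.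
- by rewrite closings_cat cu (closings_smooth st rv pR cv).
by rewrite !count_cat du dv /=; case: (a == b).
Qed.

Lemma is_tangle_unlinked D : is_long_knot D -> is_tangle (unlinked D).
Proof.
rewrite /is_long_knot /is_singular_knot /is_tangle => /andP[/andP[/eqP rD /eqP cD] /eqP dD].
rewrite /valid /closed_components /doubles run_cat rD closings_cat count_cat.
by rewrite [closings _ D]cD [count _ D]dD.
Qed.

End Components.

Definition smoothed (K : long_knot) (d : crossing (val K)) : tangle :=
  Sub (smoothing (val d)) (is_tangle_smoothing (valP K) (valP d)).
Definition link0 (K : long_knot) : tangle :=
  Sub (unlinked (val K)) (is_tangle_unlinked (valP K)).

Definition smoothing_invariant (c : category) (K : long_knot) : {freeg flat_class / int} :=
  match c with
  | Unframed => \sum_(d : crossing (val K))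
      (<< flat (smoothed d) >> - << flat (link0 K) >>) *~ sgn (slice_at (val d))
  | Framed => \sum_(d : crossing (val K))
      << flat (smoothed d) >> *~ sgn (slice_at (val d))
  end.

Definition knot_invariant (c : category) (A : zmodType) (nu : long_knot -> A) : Prop :=
  forall K K' : long_knot, equivalent c (val K) (val K') -> nu K = nu K'.

(* Kp and Km replace one double point of K by a positive, resp. negative,     *)
(* crossing.                                                                  *)
Definition resolution (K Kp Km : singular_knot) : Prop :=
  exists u v h a b o,
    [/\ sgn (Cross (Classical o) h a b) = 1,
        val K = u ++ Cross Double h a b :: v,
        val Kp = u ++ Cross (Classical o) h a b :: v &
        val Km = u ++ Cross (Classical (~~ o)) h a b :: v].

(* nus extends nu to singular knots, up to the singular equivalence.          *)
Definition vassiliev_extension (c : category) (A : zmodType)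
    (nu : long_knot -> A) (nus : singular_knot -> A) : Prop :=
  [/\ forall K : long_knot, nus (singular_of K) = nu K,
      forall K Kp Km : singular_knot, resolution K Kp Km -> nus K = nus Kp - nus Km &
      forall K K' : singular_knot, equivalent c (val K) (val K') -> nus K = nus K'].

Definition vassiliev_order_le (c : category) (A : zmodType) (nu : long_knot -> A) (n : nat) : Prop :=
  knot_invariant c nu /\
  exists nus : singular_knot -> A, vassiliev_extension c nu nus /\
    forall K : singular_knot, (n < doubles (val K))%N -> nus K = 0.

Definition vassiliev_order_one (c : category) (A : zmodType) (nu : long_knot -> A) : Prop :=
  vassiliev_order_le c nu 1 /\ ~ vassiliev_order_le c nu 0.

(* Main.v *)
(* The flat class of a smoothing ignores over/under information.  Hence a      *)
(* crossing change at d alters only the sign in the term of d: on a diagram    *)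
(* with one double point the extension of S is twice the term of that double   *)
(* point, and on two or more it vanishes.  For the invariance, all moves       *)
(* except those on kinks match the crossings of both sides with equal weights  *)
(* and equivalent smoothings (move 2: opposite weights).  A kink contributes a *)
(* split circle, which can be slid to the end of the diagram by virtual moves  *)
(* and cancels against [K^0_link] (unframed) or against the opposite kink      *)
(* (framed).  S is not of order 0: for a virtual trefoil with one double       *)
(* point, the smoothing has one classical intersection between its two         *)
(* components, and the signed number of those is a flat invariant which is 0   *)
(* on every tangle with an unlinked component.                                 *)
Require Import Defs.
From Stdlib Require Import Relations.
From mathcomp Require Import all_boot all_order all_algebra.
From mathcomp Require Import boolp zify.
From mathcomp.multinomials Require Import freeg.

Set Implicit Arguments.
Unset Strict Implicit.
Unset Printing Implicit Defensive.

Import GRing.Theory.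

Local Open Scope ring_scope.
Local Open Scope quotient_scope.

(** All sums are treated at once through [smoothing_total c e], in which every slice contributes its
    weight times the class of its smoothing, minus the class of the unlinked diagram in the unframed
    case. For [e = true] the weights are the signs and the total is S ([smoothing_invariantE]); for
    [e = false] only double points count. Flat classes ignore over and under, and [flat_value]
    extends them to double points by reading these as classical crossings. So a crossing change, or
    the replacement of a crossing by a double point, affects only the weight of the slice concerned
    ([smoothing_total_split]). The jump of S at a double point is therefore 1 - (-1) = 2 times its
    term, which is a total with [e = false], and the jump of that total at a further double point is
    0. This is [extension].

    Both totals are invariant ([smoothing_total_move]). By [move_localized] a move may be put in
    standard position; crossings away from it keep their terms, because [sim] allows the exchange of
    its two sides in any context. For the crossings inside, [regular] asks for equal total weight
    and equal sums of smoothings modulo [sim]: in move 2 the weights are opposite and the smoothings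
    equivalent, in move 3 corresponding crossings have equivalent smoothings. The single kink is the
    exception: its smoothing splits off a circle, which [flat_value_circle] identifies with the
    unlinked copy of the unknot, so its term vanishes.

    Order 0 is excluded by the jump at one crossing of a virtual trefoil; [linking_numbers]
    separates the two flat classes in it. *)

(** * Flat classes as values of diagrams *)

(* The junk value 0, taken when D is not equivalent to a tangle, makes value   *)
(* invariant without knowing that moves preserve the number of components.    *)
Definition value (D : seq slice) : {freeg flat_class / int} :=
  if pselect (exists T : tangle, flat_equivalent Unframed (val T) D) is left e
  then << flat (projT1 (cid e)) >> else 0.

Lemma value_eq D D' : flat_equivalent Unframed D D' -> value D = value D'.
Proof.
move=> DD'; rewrite /value.
case: pselect => [e|n]; case: pselect => [e'|n'] //.
- case: (cid e) => T /= TD; case: (cid e') => T' /= TD'.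
  congr (<< _ >>); apply/eqmodP/asboolP.
  exact: rst_trans TD (rst_trans _ _ _ _ _ DD' (rst_sym _ _ _ _ TD')).
- by case: n'; case: e => T TD; exists T; apply: rst_trans TD DD'.
by case: n; case: e' => T TD; exists T; apply: rst_trans TD (rst_sym _ _ _ _ DD').
Qed.

Lemma value_tangle (T : tangle) : value (val T) = << flat T >>.
Proof.
rewrite /value; case: pselect => [e|[]]; last by exists T; apply: rst_refl.
by case: (cid e) => T' /= h; congr (<< _ >>); apply/eqmodP/asboolP.
Qed.

Lemma value_move l r u v : flat_move Unframed l r ->
  valid (u ++ l ++ v) -> valid (u ++ r ++ v) -> value (u ++ l ++ v) = value (u ++ r ++ v).
Proof. by move=> m vl vr; apply/value_eq/rst_step/Applied. Qed.

(* A representative of the diagrams that differ by crossing changes; it also  *)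
(* turns double points into crossings, so that flat_value below applies to singular  *)
(* diagrams.                                                                  *)
Definition shadow (s : slice) : slice :=
  if s is Cross k h a b then Cross (if k is Virtual then k else Classical true) h a b else s.

Lemma step_shadow w s : step w (shadow s) = step w s. Proof. by case: s. Qed.
Lemma run_shadow w D : run w (map shadow D) = run w D.
Proof. by elim: D w => //= s D IH w; rewrite step_shadow; case: step. Qed.

Lemma shadow_id D : map shadow (map shadow D) = map shadow D.
Proof. by rewrite -map_comp; apply: eq_map => -[[]|h a|h a]. Qed.

Lemma value_shadow u D v : valid (u ++ D ++ v) -> doubles D = 0%N ->
  value (u ++ map shadow D ++ v) = value (u ++ D ++ v).
Proof.
elim: D u => //= s D IH u; rewrite /valid /doubles /= => vD dD.
have dD' : doubles D = 0%N by rewrite /doubles; lia.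
have E : value (u ++ shadow s :: map shadow D ++ v) = value (u ++ s :: map shadow D ++ v).
  case: s vD dD => //= -[[]||] // h a b vD dD.
  (* Whether slices fit together does not depend on the kinds of the crossings. *)
  have vo o : valid (u ++ Cross (Classical o) h a b :: map shadow D ++ v).
    move: vD; rewrite /valid -run_shadow -[run _ (u ++ _)]run_shadow !map_cat /= !map_cat.
    by rewrite shadow_id.
  by apply: (@value_move [:: Cross _ h a b] [:: Cross _ h a b] u (_ ++ v)); rewrite ?vo //;
    apply: fl_crossing_change.
rewrite E -!cat_rcons IH // /valid cat_rcons; exact: vD.
Qed.

Definition flat_value (D : seq slice) : {freeg flat_class / int} := value (map shadow D).

Lemma flat_value_double_free D : valid D -> doubles D = 0%N -> flat_value D = value D.
Proof.
by move=> vD dD; have := @value_shadow [::] D [::]; rewrite /= !cats0 /flat_value => ->.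
Qed.

(** * Raising diagrams and adding strands *)

Definition shift (n : nat) (D : seq slice) : seq slice := map (raise n) D.

Lemma shift0 D : shift 0 D = D.
Proof. by rewrite /shift -[RHS]map_id; apply: eq_map => -[k h a b|h a|h a] /=; rewrite addn0. Qed.
Lemma shiftD m n D : shift m (shift n D) = shift (n + m) D.
Proof. by rewrite /shift -map_comp; apply: eq_map => -[k h a b|h a|h a] /=; rewrite addnA. Qed.
Lemma shift_cat n D D' : shift n (D ++ D') = shift n D ++ shift n D'.
Proof. exact: map_cat. Qed.
Lemma lhs_raise n s : lhs (raise n s) = lhs s. Proof. by case: s. Qed.
Lemma rhs_raise n s : rhs (raise n s) = rhs s. Proof. by case: s. Qed.
Lemma height_raise n s : height (raise n s) = (height s + n)%N. Proof. by case: s. Qed.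
Lemma raiseC m n s : raise m (raise n s) = raise n (raise m s).
Proof. by case: s => [k h a b|h a|h a] /=; rewrite addnAC. Qed.
Lemma shadow_raise n s : shadow (raise n s) = raise n (shadow s). Proof. by case: s. Qed.
Lemma shadow_shift n D : map shadow (shift n D) = shift n (map shadow D).
Proof. by rewrite /shift -!map_comp; apply: eq_map => s /=; rewrite shadow_raise. Qed.
Lemma doubles_shift n D : doubles (shift n D) = doubles D.
Proof. by rewrite /doubles count_map; apply: eq_count => -[]. Qed.
Lemma doubles_cat D D' : doubles (D ++ D') = (doubles D + doubles D')%N.
Proof. exact: count_cat. Qed.

Lemma move_shift c n l r : move c l r -> move c (shift n l) (shift n r).
Proof.
case=> /=; rewrite /shift ?map_cat /=.
- by move=> s t st; rewrite ![raise n (raise _ t)]raiseC -(lhs_raise n s) -(rhs_raise n s);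
    apply: mv_exchange; rewrite !height_raise leq_add2r.
- by move=> h a; rewrite addSn; constructor.
- by move=> h a; rewrite addSn; constructor.
- by move=> k h a b; rewrite addSn; constructor.
- by move=> k h a b; rewrite addSn; constructor.
- by move=> [] o h a cE; rewrite /= addSn;
    [apply: (mv_R1 true)|apply: (mv_R1 false)].
- move=> up up' o h a cE; have := @mv_framed_R1 c up up' o (h + n) a cE.
  by rewrite /kink; case: up up' => [] [] /=; rewrite addSn.
- by move=> o h a b; constructor.
- by move=> [] h a; rewrite /= addSn; [apply: (mv_virtual_R1 _ true)|apply: (mv_virtual_R1 _ false)].
- by move=> h a b; constructor.
- by move=> k12 k13 k23 h a1 a2 a3 tri; rewrite addSn; constructor.
by move=> o h a b; constructor.
Qed.

Lemma step_cat u v s : size u = height s -> step (u ++ lhs s ++ v) s = Some (u ++ rhs s ++ v).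
Proof.
move=> su; rewrite /step -su size_cat leq_addr drop_size_cat // take_size_cat // eqxx /=.
by rewrite take_size_cat // addnC -drop_drop !drop_size_cat.
Qed.

Lemma run_frame p q w D w' : run w D = Some w' ->
  run (p ++ w ++ q) (shift (size p) D) = Some (p ++ w' ++ q).
Proof.
elim: D w => [|s D IH] w /=; first by case=> ->.
case st: (step w s) => [w1|] //= /IH; have [u [v [su -> ->]]] := stepP st.
have := @step_cat (p ++ u) (v ++ q) (raise (size p) s).
rewrite lhs_raise rhs_raise height_raise size_cat su addnC => /(_ erefl).
by rewrite -!catA => -> /= <-.
Qed.

(** A slice can also be read from right to left. This shows later that both sides of a move end on
    the same word. *)
Lemma step_inj w1 w2 s w' : step w1 s = Some w' -> step w2 s = Some w' -> w1 = w2.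
Proof.
move=> /stepP[u1 [v1 [s1 -> ->]]] /stepP[u2 [v2 [s2 ->]]] /eqP.
by rewrite !eqseq_cat ?s1 ?s2 // => /and3P[/eqP-> _ /eqP->].
Qed.

Lemma run_inj w1 w2 D w' : run w1 D = Some w' -> run w2 D = Some w' -> w1 = w2.
Proof.
elim: D w1 w2 => [|s D IH] w1 w2 /=; first by case=> -> [].
case st1: (step w1 s) => [x1|] //= r1; case st2: (step w2 s) => [x2|] //= r2.
by move: st2; rewrite -(IH _ _ r1 r2); apply: step_inj.
Qed.

(** * Local flat equivalence *)

(** Interchangeability in every context: strands [p] below and [q] above, slices [u] before and [v]
    after. Comparing [flat_value], instead of asking for flat equivalence, admits double points in
    [l] and [r]. *)
Definition sim (w w' : seq bool) (l r : seq slice) : Prop :=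
  [/\ run w l = Some w', run w r = Some w' &
   forall p q u v, run [:: true] u = Some (p ++ w ++ q) ->
     run (p ++ w' ++ q) v = Some [:: true] ->
     flat_value (u ++ shift (size p) l ++ v) = flat_value (u ++ shift (size p) r ++ v)].

Lemma sim_refl w w' l : run w l = Some w' -> sim w w' l l. Proof. by []. Qed.

Lemma sim_sym w w' l r : sim w w' l r -> sim w w' r l.
Proof. by case=> rl rr e; split=> // p q u v ru rv; rewrite (e p q). Qed.

Lemma sim_trans m w w' l r : sim w w' l m -> sim w w' m r -> sim w w' l r.
Proof.
by case=> rl rm e [_ rr e']; split=> // p q u v ru rv; rewrite (e p q) // (e' p q).
Qed.

(** Only shadows enter [flat_value], so crossings may be changed and double points made classical
    before a move is applied. *)
Lemma sim_shadow w w' l r l' r' : sim w w' l' r' ->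
  map shadow l = map shadow l' -> map shadow r = map shadow r' -> sim w w' l r.
Proof.
case=> rl rr e el er; split.
- by rewrite -run_shadow el run_shadow.
- by rewrite -run_shadow er run_shadow.
move=> p q u v ru rv; have := e p q u v ru rv.
by rewrite /flat_value !map_cat !shadow_shift el er.
Qed.

(** One rewriting step inside a longer piece; the equations for [L] and [R] are separate premises so
    that computation can check them. *)
Lemma sim_step A B p q w1 w1' l r w w' L R : sim w1 w1' l r ->
    run w A = Some (p ++ w1 ++ q) -> run (p ++ w1' ++ q) B = Some w' ->
    L = A ++ shift (size p) l ++ B -> R = A ++ shift (size p) r ++ B ->
  sim w w' L R.
Proof.
move=> [rl rr e] rA rB -> ->; split.
- by rewrite run_cat rA /= run_cat (run_frame _ _ rl).
- by rewrite run_cat rA /= run_cat (run_frame _ _ rr).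
move=> p0 q0 u v ru rv; rewrite !shift_cat !shiftD.
have := e (p0 ++ p) (q ++ q0) (u ++ shift (size p0) A) (shift (size p0) B ++ v).
rewrite size_cat addnC -!catA; apply.
  by rewrite run_cat ru /= (run_frame _ _ rA) -!catA.
by have := run_frame p0 q0 rB; rewrite run_cat -!catA => ->.
Qed.

(** Tangles are taken up to unframed moves in both categories, so single kinks can always be removed
    under [sim]. *)
Lemma sim_move w w' l r : move Unframed l r -> doubles l = 0%N -> doubles r = 0%N ->
  run w l = Some w' -> run w r = Some w' -> sim w w' l r.
Proof.
move=> m dl dr rl rr; split=> // p q u v ru rv.
have {}rl := run_frame p q rl; have {}rr := run_frame p q rr.
rewrite /flat_value !map_cat !value_shadow ?doubles_shift //.
- apply: value_move; first exact/fl_move/move_shift.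
    by rewrite /valid run_cat run_shadow ru /= run_cat rl /= run_shadow rv.
  by rewrite /valid run_cat run_shadow ru /= run_cat rr /= run_shadow rv.
- by rewrite /valid run_cat run_shadow ru /= run_cat rr /= run_shadow rv.
by rewrite /valid run_cat run_shadow ru /= run_cat rl /= run_shadow rv.
Qed.

Definition non_virtual (k : kind) : bool := if k is Virtual then false else true.

Lemma shadow_Cross k k' h a b : non_virtual k = non_virtual k' ->
  shadow (Cross k h a b) = shadow (Cross k' h a b).
Proof. by case: k k' => [o||] [o'||]. Qed.

Lemma sim_exchange w w' s t : (height s <= height t)%N ->
  run w [:: s; raise (size (rhs s)) t] = Some w' ->
  run w [:: raise (size (lhs s)) t; s] = Some w' ->
  sim w w' [:: s; raise (size (rhs s)) t] [:: raise (size (lhs s)) t; s].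
Proof.
move=> st r1 r2.
have e x : [/\ lhs (shadow x) = lhs x, rhs (shadow x) = rhs x & height (shadow x) = height x].
  by case: x.
have [ls rs hs] := e s; have [lt rt ht] := e t.
have d x : is_double (shadow x) = false by case: x => [[]||].
have d' n x : is_double (raise n (shadow x)) = false by case: x => [[]||].
apply: (@sim_shadow _ _ _ _ [:: shadow s; raise (size (rhs s)) (shadow t)]
   [:: raise (size (lhs s)) (shadow t); shadow s]).
- apply: sim_move; rewrite /doubles /= ?d ?d' //.
  + by rewrite -rs -ls; apply: mv_exchange; rewrite hs ht.
  + by move: r1; rewrite -run_shadow /= shadow_raise.
  by move: r2; rewrite -run_shadow /= shadow_raise.
- have -> : [:: shadow s; raise (size (rhs s)) (shadow t)] = map shadow [:: s; raise (size (rhs s)) t].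
    by rewrite /= shadow_raise.
  by rewrite shadow_id.
have -> : [:: raise (size (lhs s)) (shadow t); shadow s] = map shadow [:: raise (size (lhs s)) t; s].
  by rewrite /= shadow_raise.
by rewrite shadow_id.
Qed.

Lemma sim_zigzag_up a : sim [:: a] [:: a] [:: Cup 0 a; Cap 1 (~~ a)] [::].
Proof. by apply: sim_move => //; [constructor | case: a]. Qed.

Lemma sim_zigzag_down a : sim [:: ~~ a] [:: ~~ a] [:: Cup 1 a; Cap 0 (~~ a)] [::].
Proof. by apply: sim_move => //; [constructor | case: a]. Qed.

Lemma sim_rotate_cap k k' a b : non_virtual k = non_virtual k' ->
  sim [:: a; b; ~~ a] [:: b] [:: Cross k 0 a b; Cap 1 a] [:: Cross k' 1 b (~~ a); Cap 0 a].
Proof.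
(* [k0] represents the flat type of [k] without double points, so that [sim_move] applies;
   [sim_shadow] transfers the result. *)
move=> e; pose k0 := if non_virtual k then Classical true else Virtual.
apply: (@sim_shadow _ _ _ _ [:: Cross k0 0 a b; Cap 1 a] [:: Cross (flip k0) 1 b (~~ a); Cap 0 a]).
- apply: sim_move; first exact: mv_rotate_cap.
  1,2: by rewrite /doubles /k0 /=; case: non_virtual.
  1,2: by case: a b => [] [].
- by congr [:: _; _]; apply: shadow_Cross; rewrite /k0; case: (k).
by congr [:: _; _]; apply: shadow_Cross; rewrite /k0 e; case: (k').
Qed.

Lemma sim_rotate_cup k k' a b : non_virtual k = non_virtual k' ->
  sim [:: a] [:: b; a; ~~ b] [:: Cup 1 b; Cross k 0 a b] [:: Cup 0 b; Cross k' 1 (~~ b) a].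
Proof.
move=> e; pose k0 := if non_virtual k then Classical true else Virtual.
apply: (@sim_shadow _ _ _ _ [:: Cup 1 b; Cross k0 0 a b] [:: Cup 0 b; Cross (flip k0) 1 (~~ b) a]).
- apply: sim_move; first exact: mv_rotate_cup.
  1,2: by rewrite /doubles /k0 /=; case: non_virtual.
  1,2: by case: a b => [] [].
- by congr [:: _; _]; apply: shadow_Cross; rewrite /k0; case: (k).
by congr [:: _; _]; apply: shadow_Cross; rewrite /k0 e; case: (k').
Qed.

Lemma sim_kink up k a : sim [:: a] [:: a] (kink up k 0 a) [::].
Proof.
pose k0 := if non_virtual k then Classical true else Virtual.
apply: (@sim_shadow _ _ _ _ (kink up k0 0 a) [::]) => //.
  apply: sim_move => //.
  - by rewrite /k0; case: non_virtual; [apply: mv_R1|apply: mv_virtual_R1].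
  - by rewrite /doubles /k0; case: up; case: non_virtual.
  by case: up; case: a.
by case: up => /=; congr [:: _; _; _]; apply: shadow_Cross; rewrite /k0; case: (k).
Qed.

Lemma sim_R2 k k' a b : non_virtual k = non_virtual k' ->
  sim [:: a; b] [:: a; b] [:: Cross k 0 a b; Cross k' 0 b a] [::].
Proof.
move=> e; pose k0 := if non_virtual k then Classical true else Virtual.
apply: (@sim_shadow _ _ _ _ [:: Cross k0 0 a b; Cross (flip k0) 0 b a] [::]) => //.
  apply: sim_move => //.
  - by rewrite /k0; case: non_virtual; constructor.
  - by rewrite /doubles /k0; case: non_virtual.
  by case: a b => [] [].
by congr [:: _; _]; apply: shadow_Cross; rewrite /k0 -?e; case: (k).
Qed.

(** Move 1 in disguise: a zigzag inserted in the lower leg lets the crossing turn through a vertical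
    tangent, after which it forms a kink. *)
Lemma sim_crossed_cup k b :
  sim [::] [:: ~~ b; b] [:: Cup 0 b; Cross k 0 b (~~ b)] [:: Cup 0 (~~ b)].
Proof.
pose c := ~~ b; have cE : ~~ c = b by rewrite negbK.
have z := sim_zigzag_down c; rewrite cE in z.
apply: (sim_trans (m := [:: Cup 0 b; Cup 1 c; Cap 0 b; Cross k 0 b c])).
  apply: sim_sym.
  apply: (sim_step (A := [:: Cup 0 b]) (p := [::]) (q := [:: c]) (B := [:: Cross k 0 b c]) z) => //;
    by rewrite /c; case: b {c cE z}.
apply: (sim_trans (m := [:: Cup 0 b; Cup 1 c; Cross k 2 b c; Cap 0 b])).
  apply: (sim_step (A := [:: Cup 0 b; Cup 1 c]) (p := [::]) (q := [::]) (B := [::])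
     (@sim_exchange [:: b; c; b; c] [:: c; b] (Cap 0 b) (Cross k 0 b c) isT _ _)) => //;
  by rewrite /c; case: b {c cE z}.
apply: (sim_trans (m := [:: Cup 0 b; Cup 2 c; Cross k 1 c c; Cap 0 b])).
  apply: sim_sym.
  have := @sim_rotate_cup k k c c erefl; rewrite cE => h.
  apply: (sim_step (A := [:: Cup 0 b]) (p := [:: b]) (q := [::]) (B := [:: Cap 0 b]) h) => //;
  by rewrite /c; case: b {c cE z h}.
apply: (sim_trans (m := [:: Cup 0 c; Cup 0 b; Cross k 1 c c; Cap 0 b])).
  apply: (sim_step (A := [::]) (p := [::]) (q := [::]) (B := [:: Cross k 1 c c; Cap 0 b])
     (@sim_exchange [::] [:: b; c; c; b] (Cup 0 b) (Cup 0 c) isT _ _)) => //;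
  by rewrite /c; case: b {c cE z}.
have := sim_kink false k c; rewrite /kink cE => h.
apply: (sim_step (A := [:: Cup 0 c]) (p := [::]) (q := [:: b]) (B := [::]) h) => //;
  by rewrite /c; case: b {c cE z h}.
Qed.

Lemma sim_crossed_cap k a :
  sim [:: a; ~~ a] [::] [:: Cross k 0 a (~~ a); Cap 0 (~~ a)] [:: Cap 0 a].
Proof.
pose b := ~~ a; have bE : ~~ b = a by rewrite negbK.
have z := sim_zigzag_up b; rewrite bE in z.
apply: (sim_trans (m := [:: Cross k 0 a b; Cup 0 b; Cap 1 a; Cap 0 b])).
  apply: sim_sym.
  apply: (sim_step (A := [:: Cross k 0 a b]) (p := [::]) (q := [:: a]) (B := [:: Cap 0 b]) z) => //;
    by rewrite /b; case: a {b bE z}.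
apply: (sim_trans (m := [:: Cup 0 b; Cross k 2 a b; Cap 1 a; Cap 0 b])).
  apply: sim_sym.
  apply: (sim_step (A := [::]) (p := [::]) (q := [::]) (B := [:: Cap 1 a; Cap 0 b])
     (@sim_exchange [:: a; b] [:: b; a; b; a] (Cup 0 b) (Cross k 0 a b) isT _ _)) => //;
  by rewrite /b; case: a {b bE z}.
apply: (sim_trans (m := [:: Cup 0 b; Cross k 1 a a; Cap 2 a; Cap 0 b])).
  apply: sim_sym.
  have := @sim_rotate_cap k k a a erefl => h.
  apply: (sim_step (A := [:: Cup 0 b]) (p := [:: b]) (q := [::]) (B := [:: Cap 0 b]) h) => //;
  by rewrite /b; case: a {b bE z h}.
apply: (sim_trans (m := [:: Cup 0 b; Cross k 1 a a; Cap 0 b; Cap 0 a])).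
  apply: sim_sym.
  apply: (sim_step (A := [:: Cup 0 b; Cross k 1 a a]) (p := [::]) (q := [::]) (B := [::])
     (@sim_exchange [:: b; a; a; b] [::] (Cap 0 b) (Cap 0 a) isT _ _)) => //;
  by rewrite /b; case: a {b bE z}.
have := sim_kink false k a => h.
apply: (sim_step (A := [::]) (p := [::]) (q := [:: b]) (B := [:: Cap 0 a]) h) => //;
  by rewrite /b; case: a {b bE z h}.
Qed.

(** * Split circles *)

Definition circle (h : nat) (a : bool) : seq slice := [:: Cup h a; Cap h a].

(** The circle is pushed across the strand by a virtual move 2, its cup and cap are swung around the
    strand, and a second virtual move 2 frees it on the other side. *)
Lemma sim_circle_slide x a : sim [:: x] [:: x] (circle 1 a) (circle 0 a).
Proof.
apply: (sim_trans (m := [:: Cup 1 a; Cross Virtual 0 x a; Cross Virtual 0 a x; Cap 1 a])).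
  apply: sim_sym.
  by apply: (sim_step (A := [:: Cup 1 a]) (p := [::]) (q := [:: ~~ a]) (B := [:: Cap 1 a])
    (@sim_R2 Virtual Virtual x a erefl)) => //; case: x; case: a.
apply: (sim_trans (m := [:: Cup 0 a; Cross Virtual 1 (~~ a) x; Cross Virtual 0 a x; Cap 1 a])).
  apply: (sim_step (A := [::]) (p := [::]) (q := [::]) (B := [:: Cross Virtual 0 a x; Cap 1 a])
    (@sim_rotate_cup Virtual Virtual x a erefl)) => //; by case: x; case: a.
apply: (sim_trans (m := [:: Cup 0 a; Cross Virtual 1 (~~ a) x; Cross Virtual 1 x (~~ a); Cap 0 a])).
  apply: (sim_step (A := [:: Cup 0 a; Cross Virtual 1 (~~ a) x]) (p := [::]) (q := [::]) (B := [::])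
    (@sim_rotate_cap Virtual Virtual a x erefl)) => //; by case: x; case: a.
apply: (sim_step (A := [:: Cup 0 a]) (p := [:: a]) (q := [::]) (B := [:: Cap 0 a])
    (@sim_R2 Virtual Virtual (~~ a) x erefl)) => //; by case: x; case: a.
Qed.

(* Both circles are undone by a virtual Reidemeister move 1 from the same     *)
(* figure-eight curve.                                                        *)
Lemma sim_circle_reverse a : sim [::] [::] (circle 0 a) (circle 0 (~~ a)).
Proof.
pose b := ~~ a; have bE : ~~ b = a by rewrite negbK.
apply: (sim_trans (m := [:: Cup 0 a; Cup 0 b; Cross Virtual 1 a a; Cap 0 b; Cap 0 a])).
  apply: sim_sym.
  by apply: (sim_step (A := [:: Cup 0 a]) (p := [::]) (q := [:: b]) (B := [:: Cap 0 a])
    (sim_kink false Virtual a)) => //; rewrite /b; case: a {b bE}.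
apply: (sim_trans (m := [:: Cup 0 b; Cup 2 a; Cross Virtual 1 a a; Cap 0 b; Cap 0 a])).
  apply: sim_sym.
  apply: (sim_step (A := [::]) (p := [::]) (q := [::]) (B := [:: Cross Virtual 1 a a; Cap 0 b; Cap 0 a])
     (@sim_exchange [::] [:: b; a; a; b] (Cup 0 b) (Cup 0 a) isT _ _)) => //;
  by rewrite /b; case: a {b bE}.
apply: (sim_trans (m := [:: Cup 0 b; Cup 2 a; Cross Virtual 1 a a; Cap 2 a; Cap 0 b])).
  apply: (sim_step (A := [:: Cup 0 b; Cup 2 a; Cross Virtual 1 a a]) (p := [::]) (q := [::]) (B := [::])
     (@sim_exchange [:: b; a; a; b] [::] (Cap 0 b) (Cap 0 a) isT _ _)) => //;
  by rewrite /b; case: a {b bE}.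
apply: (sim_step (A := [:: Cup 0 b]) (p := [:: b]) (q := [::]) (B := [:: Cap 0 b])
    (sim_kink true Virtual a)) => //; by rewrite /b; case: a {b bE}.
Qed.

Lemma raise0 s : raise 0 s = s.
Proof. by case: s => [k h a b|h a|h a] /=; rewrite addn0. Qed.

Lemma sim_flat_value w w' l r u v : sim w w' l r -> run [:: true] u = Some w ->
  run w' v = Some [:: true] -> flat_value (u ++ l ++ v) = flat_value (u ++ r ++ v).
Proof.
by case=> _ _ e ru rv; have := e [::] [::] u v; rewrite !shift0 !cats0 => /(_ ru rv).
Qed.

Lemma sim_exchange_words u m v s t : size u = height s -> height t = (size u + size m)%N ->
  sim (u ++ lhs s ++ m ++ lhs t ++ v) (u ++ rhs s ++ m ++ rhs t ++ v)
    [:: s; raise (size (rhs s)) t] [:: raise (size (lhs s)) t; s].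
Proof.
move=> su st; apply: sim_exchange; first by rewrite -su st leq_addr.
- rewrite /= step_cat //=.
  have := @step_cat (u ++ rhs s ++ m) v (raise (size (rhs s)) t).
  rewrite lhs_raise rhs_raise height_raise -!catA => -> //.
  by rewrite !size_cat; lia.
have := @step_cat (u ++ lhs s ++ m) v (raise (size (lhs s)) t).
rewrite /= lhs_raise rhs_raise height_raise -!catA => -> /=; first by rewrite step_cat.
by rewrite !size_cat; lia.
Qed.

Lemma exchange_words w w' s t : (height s <= height t)%N ->
  run w [:: s; raise (size (rhs s)) t] = Some w' ->
  exists u m v, [/\ size u = height s, height t = (size u + size m)%N,
    w = u ++ lhs s ++ m ++ lhs t ++ v & w' = u ++ rhs s ++ m ++ rhs t ++ v].
Proof.
move=> st /=; case s1: (step w s) => [w1|] //=; case s2: (step w1 _) => [w2|] //= [<-].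
have [u [x [su -> w1E]]] := stepP s1; have [y [v []]] := stepP s2.
rewrite lhs_raise rhs_raise height_raise => sy w1E' ->.
pose m := drop (size u + size (rhs s)) y.
have yE : y = u ++ rhs s ++ m.
  rewrite /m -size_cat catA -[LHS](cat_take_drop (size (u ++ rhs s))); congr (_ ++ _).
  have := congr1 (take (size (u ++ rhs s))) w1E; rewrite catA take_size_cat // w1E' takel_cat //.
  by rewrite size_cat sy su; lia.
exists u, m, v; split=> //.
- by move: sy; rewrite yE !size_cat; lia.
- congr (u ++ (lhs s ++ _)).
  move/eqP: w1E; rewrite w1E' yE -!catA eqseq_cat // eqxx /= eqseq_cat // eqxx /=.
  by move/eqP.
by rewrite yE -!catA.
Qed.

(** At height 0 the cap and the cup of the circle both lie below [s] and commute with it. *)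
Lemma sim_circle_pass w w' s a : step w s = Some w' ->
  sim w w' (circle 0 a ++ [:: s]) (s :: circle 0 a).
Proof.
move=> st; have [u [v [su -> ->]]] := stepP st.
have up := @sim_exchange_words [::] u v (Cup 0 a) s erefl (esym su).
have dn := @sim_exchange_words [::] u v (Cap 0 a) s erefl (esym su).
rewrite /= raise0 in up dn.
apply: (sim_trans (m := [:: Cup 0 a; raise 2 s; Cap 0 a])).
  apply: (sim_step (A := [:: Cup 0 a]) (p := [::]) (q := [::]) (B := [::]) dn) => //=;
  by rewrite ?cats0 ?addn0 ?raise0 // /step /= ?take0 ?drop0.
apply: (sim_step (A := [::]) (p := [::]) (q := [::]) (B := [:: Cap 0 a]) up) => //=;
by rewrite ?cats0 ?addn0 ?raise0 // /step /= ?take0 ?drop0 ?eqxx.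
Qed.

Lemma flat_value_circle_down p q u v a : run [:: true] u = Some (p ++ q) ->
  run (p ++ q) v = Some [:: true] ->
  flat_value (u ++ circle (size p) a ++ v) = flat_value (u ++ circle 0 a ++ v).
Proof.
elim/last_ind: p q => // p x IH q; rewrite cat_rcons => ru rv.
rewrite -(IH (x :: q)) // size_rcons.
have [_ _ /(_ p q u v)] := sim_circle_slide x a.
by rewrite /circle /shift /= add0n add1n; apply.
Qed.

Lemma flat_value_circle_right w u v a : run [:: true] u = Some w -> run w v = Some [:: true] ->
  flat_value (u ++ circle 0 a ++ v) = flat_value (u ++ v ++ circle 0 a).
Proof.
elim: v u w => [|s v IH] u w ru //=.
case st: (step w s) => [w'|] //= rv.
have ru' : run [:: true] (rcons u s) = Some w' by rewrite -cats1 run_cat ru /= st.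
have := IH _ _ ru' rv; rewrite !cat_rcons => <-.
exact: sim_flat_value (sim_circle_pass a st) ru rv.
Qed.

(** The circle is pushed down to height 0 and then to the right end of the diagram. *)
Lemma flat_value_circle p q u v a : run [:: true] u = Some (p ++ q) ->
  run (p ++ q) v = Some [:: true] ->
  flat_value (u ++ circle (size p) a ++ v) = flat_value (unlinked (u ++ v)).
Proof.
move=> ru rv; have ruv : run [:: true] (u ++ v) = Some [:: true] by rewrite run_cat ru.
rewrite (flat_value_circle_down _ ru rv) (flat_value_circle_right _ ru rv) catA.
(* It remains to orient the circle as in [unlinked] and to lift it over the long strand. *)
have -> : flat_value ((u ++ v) ++ circle 0 a) = flat_value ((u ++ v) ++ circle 0 true).
  case: a; first by [].
  have [_ _ /(_ [::] [:: true] (u ++ v) [::])] := sim_circle_reverse false.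
  by rewrite !shift0 !cats0; apply.
have := sim_flat_value (v := [::]) (sim_circle_slide true true) ruv erefl.
by rewrite !cats0 => <-.
Qed.

(** * Weighted sums over smoothings *)

(* e = true: the weights in S; e = false: those selecting the double points.  *)
Definition weight (e : bool) (s : slice) : int := if e then sgn s else (is_double s)%:Z.
Definition wsum (e : bool) (D : seq slice) : int := \sum_(s <- D) weight e s.

(** All slices are summed over, since those not counted have weight 0. Absorbing the prefix into [f]
    makes the sum split along concatenations. *)
Fixpoint smoothing_sum (M : zmodType) (e : bool) (f : seq slice -> M) (D : seq slice) : M :=
  if D is s :: D' then
    f (smooth_slice s ++ D') *~ weight e s + smoothing_sum e (fun x => f (s :: x)) D'
  else 0.

Lemma weight_Cap e h a : weight e (Cap h a) = 0. Proof. by case: e. Qed.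
Lemma weight_Cup e h a : weight e (Cup h a) = 0. Proof. by case: e. Qed.
Lemma weight_virtual e k h a b : non_virtual k = false -> weight e (Cross k h a b) = 0.
Proof. by case: e k => [] [o||]. Qed.
Lemma weight_raise e n s : weight e (raise n s) = weight e s. Proof. by case: e s => [] []. Qed.
Lemma weight_height e k h h' a b : weight e (Cross k h a b) = weight e (Cross k h' a b).
Proof. by case: e. Qed.
Lemma weight_swap e k h a b : weight e (Cross k h a b) = weight e (Cross k h b a).
Proof. by case: e k => [] //= [o||] //=; rewrite eq_sym. Qed.
(** The sign is a determinant, hence unchanged by rotation; a quarter turn exchanges ascending and
    descending strands and reverses one of them as read from left to right. *)
Lemma weight_rotate e k h h' a b :
  weight e (Cross (flip k) h b (~~ a)) = weight e (Cross k h' a b).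
Proof. by case: e k => [] //= [o||] //=; case: o a b => [] [] []. Qed.
Lemma weight_rotate' e k h h' a b :
  weight e (Cross (flip k) h (~~ b) a) = weight e (Cross k h' a b).
Proof. by rewrite weight_swap (weight_rotate _ _ _ h') weight_swap. Qed.
Lemma weight_opposite e o h a b :
  weight e (Cross (Classical (~~ o)) h a b) = - weight e (Cross (Classical o) h a b).
Proof. by case: e => //=; case: o a b => [] [] []. Qed.

Lemma wsum_cat e D D' : wsum e (D ++ D') = wsum e D + wsum e D'.
Proof. exact: big_cat. Qed.
Lemma wsum_shift e n D : wsum e (shift n D) = wsum e D.
Proof. by rewrite /wsum big_map; apply: eq_bigr => s _; rewrite weight_raise. Qed.

Lemma smooth_raise n s : smooth_slice (raise n s) = shift n (smooth_slice s).
Proof. by case: s => //= k h a b; case: eqP. Qed.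

Lemma eq_smoothing_sum (M : zmodType) e (f g : seq slice -> M) D :
  f =1 g -> smoothing_sum e f D = smoothing_sum e g D.
Proof. by elim: D f g => //= s D IH f g fg; rewrite fg (IH _ (fun x => g (s :: x))). Qed.

Lemma smoothing_sum_cat (M : zmodType) e (f : seq slice -> M) D D' :
  smoothing_sum e f (D ++ D') =
  smoothing_sum e (fun x => f (x ++ D')) D + smoothing_sum e (fun x => f (D ++ x)) D'.
Proof. by elim: D f => [|s D IH] f /=; rewrite ?add0r // IH catA addrA. Qed.

Lemma smoothing_sum_shift (M : zmodType) e n (f : seq slice -> M) D :
  smoothing_sum e f (shift n D) = smoothing_sum e (fun x => f (shift n x)) D.
Proof.
by elim: D f => //= s D IH f; rewrite weight_raise smooth_raise -shift_cat IH.
Qed.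

Lemma run_smooth w D w' s : step w s = Some w' -> run w (smooth_slice s ++ D) = run w' D.
Proof. by case: s => [k h a b|h a|h a] st; rewrite run_cat ?(step_smooth st) //= st. Qed.

(** Smoothing keeps the words at both ends, so only fillings between these words have to be
    compared. *)
Lemma smoothing_sum_run (M : zmodType) e w w' (f g : seq slice -> M) D : run w D = Some w' ->
  (forall x, run w x = Some w' -> f x = g x) -> smoothing_sum e f D = smoothing_sum e g D.
Proof.
elim: D w f g => //= s D IH w f g; case st: (step w s) => [w1|] //= rD fg.
rewrite fg ?(run_smooth _ st) //; congr (_ + _).
by apply: (IH w1) => // x rx; rewrite fg //= st.
Qed.

(** * Smoothings on the two sides of a move *)

(* Satisfied by all moves except the unframed move 1.                         *)
Definition regular (w w' : seq bool) (l r : seq slice) : Prop :=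
  [/\ sim w w' l r, forall e, wsum e l = wsum e r &
   forall e (f : seq slice -> {freeg flat_class / int}),
     (forall x y, sim w w' x y -> f x = f y) -> smoothing_sum e f l = smoothing_sum e f r].

Lemma non_virtual_flip k : non_virtual (flip k) = non_virtual k. Proof. by case: k. Qed.

Lemma regular_rotate_cap k a b :
  regular [:: a; b; ~~ a] [:: b] [:: Cross k 0 a b; Cap 1 a] [:: Cross (flip k) 1 b (~~ a); Cap 0 a].
Proof.
split=> [|e|e f H].
- by apply: sim_rotate_cap; rewrite non_virtual_flip.
- by rewrite /wsum !big_cons !big_nil !weight_Cap (weight_rotate _ _ _ 0).
rewrite /= !weight_Cap !mulr0z !addr0 (weight_rotate _ _ _ 0); congr (_ *~ _); apply: H.
(* The two smoothings differ by a zigzag, whose direction depends on the orientations. *)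
have up x : sim [:: x; ~~ x; ~~ x] [:: ~~ x] [:: Cap 0 x; Cup 0 (~~ x); Cap 1 x] [:: Cap 0 x].
  have z := sim_zigzag_up (~~ x); rewrite negbK in z.
  by apply: (sim_step (A := [:: Cap 0 x]) (p := [::]) (q := [::]) (B := [::]) z) => //; case: x z.
have down x : sim [:: x; x; ~~ x] [:: x] [:: Cap 1 x; Cup 1 (~~ x); Cap 0 x] [:: Cap 1 x].
  have z := sim_zigzag_down (~~ x); rewrite negbK in z.
  by apply: (sim_step (A := [:: Cap 1 x]) (p := [::]) (q := [::]) (B := [::]) z) => //; case: x z.
by case: a b => [] [] /=; [apply/sim_sym/(down true) | apply: (up true) | apply: (up false) |
  apply/sim_sym/(down false)].
Qed.

Lemma regular_rotate_cup k a b :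
  regular [:: a] [:: b; a; ~~ b] [:: Cup 1 b; Cross k 0 a b] [:: Cup 0 b; Cross (flip k) 1 (~~ b) a].
Proof.
split=> [|e|e f H].
- by apply: sim_rotate_cup; rewrite non_virtual_flip.
- by rewrite /wsum !big_cons !big_nil !weight_Cup (weight_rotate' _ _ _ 0).
rewrite /= !weight_Cup !mulr0z !addr0 !add0r (weight_rotate' _ _ _ 0); congr (_ *~ _); apply: H.
have up x : sim [:: x] [:: x; x; ~~ x] [:: Cup 1 x] [:: Cup 0 x; Cap 1 (~~ x); Cup 1 x].
  apply: sim_sym; apply: (sim_step (A := [::]) (p := [::]) (q := [::]) (B := [:: Cup 1 x])
    (sim_zigzag_up x)) => //; by case: x.
have down x : sim [:: ~~ x] [:: x; ~~ x; ~~ x] [:: Cup 1 x; Cap 0 (~~ x); Cup 0 x] [:: Cup 0 x].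
  apply: (sim_step (A := [::]) (p := [::]) (q := [::]) (B := [:: Cup 0 x])
    (sim_zigzag_down x)) => //; by case: x.
by case: a b => [] [] /=; [apply: (up true) | apply: (down false) | apply: (down true) |
  apply: (up false)].
Qed.

Lemma regular_zigzag_up a : regular [:: a] [:: a] [:: Cup 0 a; Cap 1 (~~ a)] [::].
Proof.
split=> [|e|e f H]; first exact: sim_zigzag_up.
- by rewrite /wsum !big_cons !big_nil weight_Cup weight_Cap.
by rewrite /= weight_Cup weight_Cap !mulr0z !addr0.
Qed.

Lemma regular_zigzag_down a : regular [:: ~~ a] [:: ~~ a] [:: Cup 1 a; Cap 0 (~~ a)] [::].
Proof.
split=> [|e|e f H]; first exact: sim_zigzag_down.
- by rewrite /wsum !big_cons !big_nil weight_Cup weight_Cap.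
by rewrite /= weight_Cup weight_Cap !mulr0z !addr0.
Qed.

(** For parallel strands either smoothing leaves a single crossing. For antiparallel ones it leaves
    a turn-back with a kink, on the cup or on the cap, and both kinks can be removed. *)
Lemma sim_smooth_R2 k k' a b : non_virtual k = non_virtual k' ->
  sim [:: a; b] [:: a; b] (smooth_slice (Cross k 0 a b) ++ [:: Cross k' 0 b a])
    (Cross k 0 a b :: smooth_slice (Cross k' 0 b a)).
Proof.
move=> e /=; rewrite [b == a]eq_sym; case: (eqVneq a b) => [->|ab] /=.
  apply: sim_shadow (sim_refl (l := [:: Cross k 0 b b]) _) _ _ => //; first by case: b.
  by congr [:: _]; apply: shadow_Cross.
have -> : b = ~~ a by case: a b ab => [] [].
have cup := sim_crossed_cup k' (~~ a); have cap := sim_crossed_cap k a.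
rewrite negbK in cup.
apply: (sim_trans (m := [:: Cap 0 a; Cup 0 a])).
  apply: (sim_step (A := [:: Cap 0 a]) (p := [::]) (q := [::]) (B := [::]) cup) => //;
  by case: a {ab cup cap}.
apply: sim_sym.
apply: (sim_step (A := [::]) (p := [::]) (q := [::]) (B := [:: Cup 0 a]) cap) => //;
  by case: a {ab cup cap}.
Qed.

Lemma regular_R2 o a b :
  regular [:: a; b] [:: a; b]
    [:: Cross (Classical o) 0 a b; Cross (Classical (~~ o)) 0 b a] [::].
Proof.
split=> [|e|e f H]; first exact: sim_R2.
- by rewrite /wsum !big_cons !big_nil weight_opposite weight_swap addr0 subrr.
rewrite /= addr0 weight_opposite [weight e (Cross _ _ b a)]weight_swap mulrNz.
by rewrite (H _ _ (@sim_smooth_R2 (Classical o) (Classical (~~ o)) a b erefl)) /= cats0 subrr.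
Qed.

Lemma regular_virtual_R1 up a : regular [:: a] [:: a] (kink up Virtual 0 a) [::].
Proof.
split=> [|e|e f H]; first exact: sim_kink.
- by case: up; rewrite /wsum !big_cons !big_nil weight_Cup weight_Cap weight_virtual.
by case: up; rewrite /= weight_Cup weight_Cap weight_virtual // !mulr0z !addr0.
Qed.

Lemma regular_virtual_R2 a b :
  regular [:: a; b] [:: a; b] [:: Cross Virtual 0 a b; Cross Virtual 0 b a] [::].
Proof.
split=> [|e|e f H]; first exact: sim_R2.
- by rewrite /wsum !big_cons !big_nil !weight_virtual.
by rewrite /= !weight_virtual // !mulr0z !addr0.
Qed.

Lemma regular_vertex_turn o a b : regular [:: a; b] [:: a; b]
  [:: Cross Double 0 a b; Cross (Classical o) 0 b a]
  [:: Cross (Classical o) 0 a b; Cross Double 0 b a].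
Proof.
split=> [|e|e f H].
- by apply: sim_shadow (sim_refl (l := [:: Cross Double 0 a b; Cross Double 0 b a]) _) _ _;
    case: a b => [] [].
- rewrite /wsum !big_cons !big_nil !addr0 addrC.
  by rewrite weight_swap [weight e (Cross _ _ b a)]weight_swap.
rewrite /= !addr0 !cats0 [RHS]addrC.
congr (_ + _).
  rewrite [weight e (Cross Double _ b a)]weight_swap; congr (_ *~ _).
  exact: H (@sim_smooth_R2 (Classical o) (Classical o) a b erefl).
rewrite [weight e (Cross _ _ b a)]weight_swap; congr (_ *~ _).
exact: H (sim_sym (@sim_smooth_R2 Double Double a b erefl)).
Qed.

(** A crossing with nonzero weight faces two crossings of the same flat type. Hence, once it is
    smoothed, the third strand can be slid over what remains. *)
Lemma triangle_non_virtual k12 k13 k23 : triangle k12 k13 k23 ->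
  [/\ non_virtual k12 -> non_virtual k13 = non_virtual k23,
      non_virtual k13 -> non_virtual k12 = non_virtual k23 &
      non_virtual k23 -> non_virtual k12 = non_virtual k13].
Proof. by case=> //; case. Qed.

Lemma sim_triangle k12 k13 k23 a1 a2 a3 : triangle k12 k13 k23 ->
  sim [:: a1; a2; a3] [:: a3; a2; a1]
    [:: Cross k12 0 a1 a2; Cross k13 1 a1 a3; Cross k23 0 a2 a3]
    [:: Cross k23 1 a2 a3; Cross k13 0 a1 a3; Cross k12 1 a1 a2].
Proof.
move=> tri; pose k0 k := if non_virtual k then Classical true else Virtual.
have k0E k : non_virtual k = non_virtual (k0 k) by case: k.
apply: (@sim_shadow _ _ _ _
    [:: Cross (k0 k12) 0 a1 a2; Cross (k0 k13) 1 a1 a3; Cross (k0 k23) 0 a2 a3]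
    [:: Cross (k0 k23) 1 a2 a3; Cross (k0 k13) 0 a1 a3; Cross (k0 k12) 1 a1 a2]).
- apply: sim_move.
  + apply: mv_triangle; case: tri => *; try exact: tri_classical.
    * exact: tri_detour12.
    * exact: tri_detour13.
    * exact: tri_detour23.
  + by rewrite /doubles /k0; do 3!case: non_virtual.
  + by rewrite /doubles /k0; do 3!case: non_virtual.
  + by case: a1 a2 a3 => [] [] [].
  by case: a1 a2 a3 => [] [] [].
- by congr [:: _; _; _]; apply: shadow_Cross.
by congr [:: _; _; _]; apply: shadow_Cross.
Qed.

(** [Double] stands for any kind, since smoothing ignores it. If strands 1 and 2 are parallel,
    strand 3 crosses the same two strands on both sides; otherwise it is pulled off the turn-backs
    by a move 2. *)
Lemma sim_triangle_smooth12 k k' a1 a2 a3 : non_virtual k = non_virtual k' ->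
  sim [:: a1; a2; a3] [:: a3; a2; a1]
    (smooth_slice (Cross Double 0 a1 a2) ++ [:: Cross k 1 a1 a3; Cross k' 0 a2 a3])
    [:: Cross k' 1 a2 a3, Cross k 0 a1 a3 & smooth_slice (Cross Double 1 a1 a2)].
Proof.
move=> e /=; case: (eqVneq a1 a2) => [->|a12] /=.
  apply: sim_shadow (sim_refl (l := [:: Cross k 1 a2 a3; Cross k 0 a2 a3]) _) _ _.
  - by case: a2 a3 => [] [].
  - by congr [:: _; _]; apply: shadow_Cross.
  by congr [:: _; _]; apply: shadow_Cross.
have -> : a2 = ~~ a1 by case: a1 a2 a12 => [] [].
have {a2 a12} cap := @sim_rotate_cap k k' a1 a3 e.
have cup := @sim_rotate_cup k' k a3 (~~ a1) (esym e); rewrite negbK in cup.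
apply: (sim_trans (m := [:: Cap 0 a1; Cup 1 (~~ a1)])).
  apply: (sim_trans (m := [:: Cap 0 a1; Cup 1 (~~ a1); Cross k' 0 a3 (~~ a1); Cross k' 0 (~~ a1) a3])).
    apply: sim_sym.
    apply: (sim_step (A := [:: Cap 0 a1]) (p := [::]) (q := [::])
      (B := [:: Cross k' 0 (~~ a1) a3]) cup) => //; by case: a1 a3 {cap cup} => [] [].
  apply: (sim_step (A := [:: Cap 0 a1; Cup 1 (~~ a1)]) (p := [::]) (q := [:: a1]) (B := [::])
    (@sim_R2 k' k' a3 (~~ a1) erefl)) => //; by case: a1 a3 {cap cup} => [] [].
apply: sim_sym.
apply: (sim_trans (m := [:: Cross k' 1 (~~ a1) a3; Cross k' 1 a3 (~~ a1); Cap 0 a1; Cup 1 (~~ a1)])).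
  apply: (sim_step (A := [:: Cross k' 1 (~~ a1) a3]) (p := [::]) (q := [::])
      (B := [:: Cup 1 (~~ a1)]) cap) => //; by case: a1 a3 {cap cup} => [] [].
apply: (sim_step (A := [::]) (p := [:: a1]) (q := [::]) (B := [:: Cap 0 a1; Cup 1 (~~ a1)])
    (@sim_R2 k' k' (~~ a1) a3 erefl)) => //; by case: a1 a3 {cap cup} => [] [].
Qed.

Lemma sim_triangle_smooth23 k k' a1 a2 a3 : non_virtual k = non_virtual k' ->
  sim [:: a1; a2; a3] [:: a3; a2; a1]
    [:: Cross k 0 a1 a2, Cross k' 1 a1 a3 & smooth_slice (Cross Double 0 a2 a3)]
    (smooth_slice (Cross Double 1 a2 a3) ++ [:: Cross k' 0 a1 a3; Cross k 1 a1 a2]).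
Proof.
move=> e /=; case: (eqVneq a2 a3) => [->|a23] /=.
  apply: sim_shadow (sim_refl (l := [:: Cross k 0 a1 a3; Cross k 1 a1 a3]) _) _ _.
  - by case: a1 a3 => [] [].
  - by congr [:: _; _]; apply: shadow_Cross.
  by congr [:: _; _]; apply: shadow_Cross.
have -> : a3 = ~~ a2 by case: a2 a3 a23 => [] [].
have {a3 a23} cap := @sim_rotate_cap k k' a2 a1 e.
have cup := @sim_rotate_cup k' k a1 (~~ a2) (esym e); rewrite negbK in cup.
apply: (sim_trans (m := [:: Cap 1 a2; Cup 0 (~~ a2)])).
  apply: (sim_trans (m := [:: Cross k 0 a1 a2; Cross k 0 a2 a1; Cap 1 a2; Cup 0 (~~ a2)])).
    apply: sim_sym.
    apply: (sim_step (A := [:: Cross k 0 a1 a2]) (p := [::]) (q := [::])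
      (B := [:: Cup 0 (~~ a2)]) cap) => //; by case: a1 a2 {cap cup} => [] [].
  apply: (sim_step (A := [::]) (p := [::]) (q := [:: ~~ a2]) (B := [:: Cap 1 a2; Cup 0 (~~ a2)])
    (@sim_R2 k k a1 a2 erefl)) => //; by case: a1 a2 {cap cup} => [] [].
apply: sim_sym.
apply: (sim_trans (m := [:: Cap 1 a2; Cup 0 (~~ a2); Cross k 1 a2 a1; Cross k 1 a1 a2])).
  apply: (sim_step (A := [:: Cap 1 a2]) (p := [::]) (q := [::])
      (B := [:: Cross k 1 a1 a2]) cup) => //; by case: a1 a2 {cap cup} => [] [].
apply: (sim_step (A := [:: Cap 1 a2; Cup 0 (~~ a2)]) (p := [:: ~~ a2]) (q := [::]) (B := [::])
    (@sim_R2 k k a2 a1 erefl)) => //; by case: a1 a2 {cap cup} => [] [].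
Qed.

(** If strands 1 and 3 are parallel, the other two crossings cancel by a move 2 on either side;
    otherwise strand 2 is swung past the cap and the cup. *)
Lemma sim_triangle_smooth13 k k' a1 a2 a3 : non_virtual k = non_virtual k' ->
  sim [:: a1; a2; a3] [:: a3; a2; a1]
    (Cross k 0 a1 a2 :: smooth_slice (Cross Double 1 a1 a3) ++ [:: Cross k' 0 a2 a3])
    (Cross k' 1 a2 a3 :: smooth_slice (Cross Double 0 a1 a3) ++ [:: Cross k 1 a1 a2]).
Proof.
move=> e /=; case: (eqVneq a1 a3) => [->|a13] /=.
  apply: (sim_trans (m := [::])).
    apply: (sim_step (A := [::]) (p := [::]) (q := [:: a3]) (B := [::]) (@sim_R2 k k' a3 a2 e)) => //;
    by case: a2 a3 => [] [].
  apply: sim_sym.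
  apply: (sim_step (A := [::]) (p := [:: a3]) (q := [::]) (B := [::])
    (@sim_R2 k' k a2 a3 (esym e))) => //; by case: a2 a3 => [] [].
have -> : a3 = ~~ a1 by case: a1 a3 a13 => [] [].
have {a3 a13} cap := @sim_rotate_cap k k' a1 a2 e.
have cup := @sim_rotate_cup k' k a2 (~~ a1) (esym e); rewrite negbK in cup.
apply: (sim_trans (m := [:: Cross k' 1 a2 (~~ a1); Cap 0 a1; Cup 1 (~~ a1); Cross k' 0 a2 (~~ a1)])).
  apply: (sim_step (A := [::]) (p := [::]) (q := [::])
    (B := [:: Cup 1 (~~ a1); Cross k' 0 a2 (~~ a1)]) cap) => //; by case: a1 a2 {cap cup} => [] [].
apply: (sim_step (A := [:: Cross k' 1 a2 (~~ a1); Cap 0 a1]) (p := [::]) (q := [::])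
    (B := [::]) cup) => //; by case: a1 a2 {cap cup} => [] [].
Qed.

Lemma regular_triangle k12 k13 k23 a1 a2 a3 : triangle k12 k13 k23 ->
  regular [:: a1; a2; a3] [:: a3; a2; a1]
    [:: Cross k12 0 a1 a2; Cross k13 1 a1 a3; Cross k23 0 a2 a3]
    [:: Cross k23 1 a2 a3; Cross k13 0 a1 a3; Cross k12 1 a1 a2].
Proof.
move=> tri; split=> [|e|e f H]; first exact: sim_triangle.
  rewrite /wsum !big_cons !big_nil !addr0 ![weight e (Cross _ 1 _ _)](weight_height _ _ _ 0).
  by rewrite addrA [LHS]addrC; congr (_ + _); rewrite addrC.
have [n12 n13 n23] := triangle_non_virtual tri.
rewrite /= !addr0 !cats0 ![weight e (Cross _ 1 _ _)](weight_height _ _ _ 0).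
(* A virtual crossing has weight 0, so its smoothings need no comparison. *)
have nv k h a b x y : (non_virtual k -> f x = f y) ->
    f x *~ weight e (Cross k h a b) = f y *~ weight e (Cross k h a b).
  by case E: (non_virtual k); [move=> -> | rewrite weight_virtual].
rewrite addrA [LHS]addrC; congr (_ + _); last rewrite addrC; last congr (_ + _).
- apply: nv => /n23 e23; exact: (H _ _ (sim_triangle_smooth23 a1 a2 a3 e23)).
- apply: nv => /n13 e13; exact: (H _ _ (sim_triangle_smooth13 a1 a2 a3 e13)).
apply: nv => /n12 e12; exact: (H _ _ (sim_triangle_smooth12 a1 a2 a3 e12)).
Qed.

Lemma step_lhs s v : height s = 0%N -> step (lhs s ++ v) s = Some (rhs s ++ v).
Proof. by move=> hs; apply: (@step_cat [::]). Qed.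

Lemma sim_exchange_smooth_lower u m v s t : size u = height s ->
    height t = (size u + size m)%N ->
  sim (u ++ lhs s ++ m ++ lhs t ++ v) (u ++ rhs s ++ m ++ rhs t ++ v)
    (smooth_slice s ++ [:: raise (size (rhs s)) t])
    (raise (size (lhs s)) t :: smooth_slice s).
Proof.
move=> su st; have e := sim_exchange_words v su st.
case: s su e => //= k h a b su e; case: (eqVneq a b) e => [->|ab] e.
  apply: sim_refl; have [] := e => /=.
  by have /= -> := @step_cat u (m ++ lhs t ++ v) (Cross k h b b) su.
have {ab e} -> : b = ~~ a by case: a b ab {e} => [] [].
have cup := @sim_exchange_words u m v (Cup h (~~ a)) t su st.
have cap := @sim_exchange_words u m v (Cap h a) t su st.
rewrite /= negbK raise0 in cup; rewrite /= raise0 in cap.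
apply: (sim_trans (m := [:: Cap h a; t; Cup h (~~ a)])).
  apply: (sim_step (A := [:: Cap h a]) (p := [::]) (q := [::]) (B := [::]) cup);
    rewrite //= ?cats0 -/(shift 0 _) ?shift0 ?raise0 ?addn0 //.
  by have /= -> := @step_cat u (m ++ lhs t ++ v) (Cap h a) su.
apply: (sim_step (A := [::]) (p := [::]) (q := [::]) (B := [:: Cup h (~~ a)]) cap);
  rewrite //= ?cats0 -/(shift 0 _) ?shift0 ?raise0 ?addn0 //.
by have /= -> := @step_cat u (m ++ rhs t ++ v) (Cup h (~~ a)) su; rewrite /= ?negbK.
Qed.

Lemma sim_exchange_smooth_upper u m v s t : size u = height s ->
    height t = (size u + size m)%N ->
  sim (u ++ lhs s ++ m ++ lhs t ++ v) (u ++ rhs s ++ m ++ rhs t ++ v)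
    (s :: smooth_slice (raise (size (rhs s)) t))
    (smooth_slice (raise (size (lhs s)) t) ++ [:: s]).
Proof.
move=> su st; have e := sim_exchange_words v su st.
case: t st e => //= k h a b st e; case: (eqVneq a b) e => [->|ab] e.
  by apply: sim_refl; rewrite /= step_cat.
have {ab e} -> : b = ~~ a by case: a b ab {e} => [] [].
have cup := @sim_exchange_words u m v s (Cup h (~~ a)) su st.
have cap := @sim_exchange_words u m v s (Cap h a) su st.
rewrite /= negbK in cup; rewrite /= in cap.
apply: (sim_trans (m := [:: Cap (h + size (lhs s)) a; s; Cup (h + size (rhs s)) (~~ a)])).
  apply: (sim_step (A := [::]) (p := [::]) (q := [::])
      (B := [:: Cup (h + size (rhs s)) (~~ a)]) cap);
    rewrite //= ?cats0 -/(shift 0 _) ?shift0 ?raise0 ?addn0 //.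
  have := @step_cat (u ++ rhs s ++ m) v (Cup (h + size (rhs s)) (~~ a)).
  by rewrite -!catA /= negbK => -> //; rewrite !size_cat; lia.
apply: (sim_step (A := [:: Cap (h + size (lhs s)) a]) (p := [::]) (q := [::]) (B := [::]) cup);
  rewrite //= ?cats0 -/(shift 0 _) ?shift0 ?raise0 ?addn0 //.
have := @step_cat (u ++ lhs s ++ m) v (Cap (h + size (lhs s)) a).
by rewrite -!catA /= => -> //; rewrite !size_cat; lia.
Qed.

Lemma regular_exchange u m v s t : size u = height s -> height t = (size u + size m)%N ->
  regular (u ++ lhs s ++ m ++ lhs t ++ v) (u ++ rhs s ++ m ++ rhs t ++ v)
    [:: s; raise (size (rhs s)) t] [:: raise (size (lhs s)) t; s].
Proof.
move=> su st; split=> [|e|e f H]; first exact: sim_exchange_words.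
  by rewrite /wsum !big_cons !big_nil !weight_raise !addr0 addrC.
rewrite /= !addr0 !cats0 !weight_raise addrC.
rewrite (H _ _ (sim_exchange_smooth_lower v su st)).
by rewrite (H _ _ (sim_exchange_smooth_upper v su st)).
Qed.

(** What a kink becomes when its crossing is smoothed. *)
Definition loop (up : bool) (a : bool) : seq slice :=
  if up then circle 1 a else circle 0 (~~ a).

Lemma smoothing_sum_kink (M : zmodType) e (f : seq slice -> M) up k a :
  smoothing_sum e f (kink up k 0 a) = f (loop up a) *~ weight e (Cross k 0 a a).
Proof.
by case: up => /=; rewrite weight_Cup weight_Cap ?(weight_height e k 1 0) eqxx !mulr0z add0r !addr0.
Qed.

Lemma wsum_kink e up k a : wsum e (kink up k 0 a) = weight e (Cross k 0 a a).
Proof.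
case: up; rewrite /wsum !big_cons big_nil weight_Cup weight_Cap ?(weight_height e k 1 0);
by rewrite add0r !addr0.
Qed.

Lemma sim_loop up up' a : sim [:: a] [:: a] (loop up a) (loop up' a).
Proof.
have e : sim [:: a] [:: a] (loop true a) (loop false a).
  apply: sim_trans (sim_circle_slide a a) _.
  by apply: (sim_step (A := [::]) (p := [::]) (q := [:: a]) (B := [::]) (sim_circle_reverse a));
    case: a.
have r b : run [:: a] (loop b a) = Some [:: a] by case: b a {e} => [] [].
by case: up up' => [] []; [apply: sim_refl|exact: e|exact: sim_sym|apply: sim_refl].
Qed.

(** Smoothing one kink leaves a circle beside the strand, and the other kink is then flatly trivial.
    The circle can lie on either side, so the two terms agree up to their opposite signs. *)
Lemma regular_framed_R1 up up' o a : regular [:: a] [:: a]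
  (kink up (Classical o) 0 a ++ kink up' (Classical (~~ o)) 0 a) [::].
Proof.
have [rk _ _] := sim_kink up (Classical o) a.
have [rk' _ _] := sim_kink up' (Classical (~~ o)) a.
have r b : run [:: a] (loop b a) = Some [:: a] by case: b a {rk rk'} => [] [].
split=> [|e|e f H].
- apply: (sim_trans (m := kink up' (Classical (~~ o)) 0 a)); last exact: sim_kink.
  apply: (sim_step (A := [::]) (p := [::]) (q := [::])
    (B := kink up' (Classical (~~ o)) 0 a) (sim_kink up (Classical o) a)); by rewrite ?shift0.
- by rewrite wsum_cat !wsum_kink weight_opposite subrr /wsum big_nil.
rewrite smoothing_sum_cat !smoothing_sum_kink weight_opposite.
have -> : f (loop up a ++ kink up' (Classical (~~ o)) 0 a) = f (loop up a).
  apply: H.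
  apply: (sim_step (A := loop up a) (p := [::]) (q := [::]) (B := [::])
    (sim_kink up' (Classical (~~ o)) a)); by rewrite ?shift0 ?cats0 ?r.
have -> : f (kink up (Classical o) 0 a ++ loop up' a) = f (loop up a).
  rewrite -(H _ _ (sim_loop up' up a)); apply: H.
  apply: (sim_step (A := [::]) (p := [::]) (q := [::]) (B := loop up' a)
    (sim_kink up (Classical o) a)); by rewrite ?shift0 ?cats0 ?r.
by rewrite mulrNz subrr.
Qed.

(** * Bringing a move into standard position *)

Lemma run_shift_inv h D W W' : (h <= size W)%N -> run W (shift h D) = Some W' ->
  exists2 W1', W' = take h W ++ W1' & run (drop h W) D = Some W1'.
Proof.
elim: D W => [|s D IH] W hW /=.
  by case=> <-; exists (drop h W); rewrite ?cat_take_drop.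
case st: (step W _) => [W2|] //= /IH; have [u [v []]] := stepP st.
rewrite height_raise lhs_raise rhs_raise => su -> ->.
have hu : (h <= size u)%N by lia.
rewrite !takel_cat // 2![drop h (u ++ _)]drop_cat; case: ltnP => hu'.
  rewrite step_cat /=; last by rewrite size_drop; lia.
  by apply; rewrite size_cat; lia.
have -> : (h - size u = 0)%N by lia.
rewrite !drop0 step_lhs //=; last by lia.
by apply; rewrite size_cat; lia.
Qed.

Lemma run_consP w s D w' : run w (s :: D) = Some w' -> exists u v,
  [/\ size u = height s, w = u ++ lhs s ++ v & run (u ++ rhs s ++ v) D = Some w'].
Proof.
rewrite /=; case st: (step w s) => [w1|] //=.
by have [u [v [su -> ->]]] := stepP st; exists u, v.
Qed.

(* The moves, based at height 0 and read between the shortest words they fit. *)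
Inductive local_move (c : category) : seq bool -> seq bool -> seq slice -> seq slice -> Prop :=
  | lm_exchange u m v s t : size u = height s -> height t = (size u + size m)%N ->
      local_move c (u ++ lhs s ++ m ++ lhs t ++ v) (u ++ rhs s ++ m ++ rhs t ++ v)
        [:: s; raise (size (rhs s)) t] [:: raise (size (lhs s)) t; s]
  | lm_zigzag_up a : local_move c [:: a] [:: a] [:: Cup 0 a; Cap 1 (~~ a)] [::]
  | lm_zigzag_down a : local_move c [:: ~~ a] [:: ~~ a] [:: Cup 1 a; Cap 0 (~~ a)] [::]
  | lm_rotate_cap k a b : local_move c [:: a; b; ~~ a] [:: b]
      [:: Cross k 0 a b; Cap 1 a] [:: Cross (flip k) 1 b (~~ a); Cap 0 a]
  | lm_rotate_cup k a b : local_move c [:: a] [:: b; a; ~~ b]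
      [:: Cup 1 b; Cross k 0 a b] [:: Cup 0 b; Cross (flip k) 1 (~~ b) a]
  | lm_R1 up o a : c = Unframed ->
      local_move c [:: a] [:: a] (kink up (Classical o) 0 a) [::]
  | lm_framed_R1 up up' o a : local_move c [:: a] [:: a]
      (kink up (Classical o) 0 a ++ kink up' (Classical (~~ o)) 0 a) [::]
  | lm_R2 o a b : local_move c [:: a; b] [:: a; b]
      [:: Cross (Classical o) 0 a b; Cross (Classical (~~ o)) 0 b a] [::]
  | lm_virtual_R1 up a : local_move c [:: a] [:: a] (kink up Virtual 0 a) [::]
  | lm_virtual_R2 a b : local_move c [:: a; b] [:: a; b]
      [:: Cross Virtual 0 a b; Cross Virtual 0 b a] [::]
  | lm_triangle k12 k13 k23 a1 a2 a3 : triangle k12 k13 k23 ->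
      local_move c [:: a1; a2; a3] [:: a3; a2; a1]
        [:: Cross k12 0 a1 a2; Cross k13 1 a1 a3; Cross k23 0 a2 a3]
        [:: Cross k23 1 a2 a3; Cross k13 0 a1 a3; Cross k12 1 a1 a2]
  | lm_vertex_turn o a b : local_move c [:: a; b] [:: a; b]
      [:: Cross Double 0 a b; Cross (Classical o) 0 b a]
      [:: Cross (Classical o) 0 a b; Cross Double 0 b a].

Lemma local_move_regular c w w' l r : local_move c w w' l r ->
  regular w w' l r \/ c = Unframed /\
    exists up o a, [/\ w = [:: a], w' = [:: a], l = kink up (Classical o) 0 a & r = [::]].
Proof.
case.
- by left; apply: regular_exchange.
- by left; apply: regular_zigzag_up.
- by left; apply: regular_zigzag_down.
- by left; apply: regular_rotate_cap.
- by left; apply: regular_rotate_cup.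
- by move=> up o a cE; right; split=> //; exists up, o, a.
- by left; apply: regular_framed_R1.
- by left; apply: regular_R2.
- by left; apply: regular_virtual_R1.
- by left; apply: regular_virtual_R2.
- by left; apply: regular_triangle.
by left; apply: regular_vertex_turn.
Qed.

Definition localized (c : category) (W W' : seq bool) (l r : seq slice) : Prop :=
  exists p q w w' l0 r0,
  [/\ W = p ++ w ++ q, W' = p ++ w' ++ q, l = shift (size p) l0, r = shift (size p) r0 &
      local_move c w w' l0 r0].

Lemma run_shift_height h s D W W' : run W (shift h (s :: D)) = Some W' -> (h <= size W)%N.
Proof.
by case/run_consP=> u [v [su -> _]]; move: su; rewrite height_raise size_cat; lia.
Qed.

Lemma localize c h w w' s D l r0 r q W W' :
    run W (shift h (s :: D)) = Some W' -> drop h W = w ++ q ->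
    run w (s :: D) = Some w' -> local_move c w w' (s :: D) r0 ->
    l = shift h (s :: D) -> r = shift h r0 ->
  localized c W W' l r.
Proof.
move=> rW dW rl H -> ->; have hW := run_shift_height rW.
exists (take h W), q, w, w', (s :: D), r0.
have [W1' -> ] := run_shift_inv hW rW; rewrite dW.
have -> : run (w ++ q) (s :: D) = Some (w' ++ q).
  by rewrite -(shift0 (s :: D)); apply: (run_frame [::] q rl).
case=> <-.
by rewrite size_takel // -dW cat_take_drop.
Qed.

Lemma run_shift_drop h s D W W' : run W (shift h (s :: D)) = Some W' ->
  exists W1', run (drop h W) (s :: D) = Some W1'.
Proof.
by move=> rW; have [W1 _ r1] := run_shift_inv (run_shift_height rW) rW; exists W1.
Qed.

Lemma kink_word up k a D w w' : run w (kink up k 0 a ++ D) = Some w' -> exists q, w = a :: q.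
Proof.
case: up => /run_consP[u [v [su -> /run_consP[u2 [v2 [su2 + _]]]]]]; move: su su2.
  by case: u => [|x [|]] // _; case: u2 => //= _ [-> _]; exists v.
by case: u => // _; case: u2 => [|x [|]] //= _ [_ _ ->]; exists v2.
Qed.

Lemma two_words s t w w' : run w [:: s; t] = Some w' -> exists u v u2 v2,
  [/\ size u = height s, size u2 = height t, w = u ++ lhs s ++ v &
      u ++ rhs s ++ v = u2 ++ lhs t ++ v2].
Proof.
by case/run_consP=> u [v [su -> /run_consP[u2 [v2 [su2 E _]]]]]; exists u, v, u2, v2.
Qed.

(** That the left side fits on [W] determines the strands met by the move: the first slice exhibits
    those it consumes, the later ones force the rest. *)
Lemma move_localized c l r W W' : move c l r -> run W l = Some W' -> run W r = Some W' ->
  localized c W W' l r.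
Proof.
move=> m; case: m => [s t st|h a|h a|k h a b|k h a b|up o h a cE|up up' o h a cE|o h a b|up h a
  |h a b|k12 k13 k23 h a1 a2 a3 tri|o h a b] rl rr.
- have [u [m [v [su ht -> ->]]]] := exchange_words st rl.
  exists [::], [::], (u ++ lhs s ++ m ++ lhs t ++ v), (u ++ rhs s ++ m ++ rhs t ++ v).
  exists [:: s; raise (size (rhs s)) t], [:: raise (size (lhs s)) t; s].
  by rewrite !cats0 !shift0; split=> //; apply: lm_exchange.
- have rl' : run W (shift h [:: Cup 0 a; Cap 1 (~~ a)]) = Some W' by [].
  have [W1] := run_shift_drop rl'; case/two_words=> u [v [u2 [v2 [/= su su2 E E2]]]].
  case: u su E E2 => // _ E; case: u2 su2 => [|x [|]] //= _ [_ E2].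
  rewrite E2 /= negbK in E.
  apply: (localize (w := [:: a]) (w' := [:: a]) (r0 := [::]) rl' E) => //; first by case: (a).
  exact: lm_zigzag_up.
- have rl' : run W (shift h [:: Cup 1 a; Cap 0 (~~ a)]) = Some W' by [].
  have [W1] := run_shift_drop rl'; case/two_words=> u [v [u2 [v2 [/= su su2 E E2]]]].
  case: u2 su2 E2 => // _; case: u su E => [|x [|]] //= _ E [E2 _ _].
  rewrite E2 in E.
  apply: (localize (w := [:: ~~ a]) (w' := [:: ~~ a]) (r0 := [::]) rl' E) => //; first by case: (a).
  exact: lm_zigzag_down.
- have rl' : run W (shift h [:: Cross k 0 a b; Cap 1 a]) = Some W' by [].
  have [W1] := run_shift_drop rl'; case/two_words=> u [v [u2 [v2 [/= su su2 E E2]]]].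
  case: u su E E2 => // _ E; case: u2 su2 => [|x [|]] //= _ [_ E2].
  rewrite E2 in E.
  apply: (localize (w := [:: a; b; ~~ a]) (w' := [:: b])
    (r0 := [:: Cross (flip k) 1 b (~~ a); Cap 0 a]) rl' E) => //; last first.
  + exact: lm_rotate_cap.
  + by case: (a) (b) => [] [].
- have rl' : run W (shift h [:: Cup 1 b; Cross k 0 a b]) = Some W' by [].
  have [W1] := run_shift_drop rl'; case/two_words=> u [v [u2 [v2 [/= su su2 E E2]]]].
  case: u2 su2 E2 => // _; case: u su E => [|x [|]] //= _ E [E2 _].
  rewrite E2 in E.
  apply: (localize (w := [:: a]) (w' := [:: b; a; ~~ b])
    (r0 := [:: Cup 0 b; Cross (flip k) 1 (~~ b) a]) rl' E) => //; last first.
  + exact: lm_rotate_cup.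
  + by case: (a) (b) => [] [].
- have [s [D kE]] : exists s D, kink up (Classical o) 0 a = s :: D.
    by case: (up); do 2!eexists.
  have lE : kink up (Classical o) h a = shift h (kink up (Classical o) 0 a) by case: (up).
  have rl' := rl; rewrite lE kE in rl'; have [W1] := run_shift_drop rl'.
  rewrite -kE -[kink _ _ _ _]cats0 => /kink_word[q E].
  apply: (localize (w := [:: a]) (w' := [:: a]) (r0 := [::]) rl' E) => //; rewrite -?kE //.
  + by case: (up); case: (a).
  exact: lm_R1.
- have [s [D kE]] : exists s D,
      kink up (Classical o) 0 a ++ kink up' (Classical (~~ o)) 0 a = s :: D.
    by case: (up); do 2!eexists.
  have lE : kink up (Classical o) h a ++ kink up' (Classical (~~ o)) h a =
      shift h (kink up (Classical o) 0 a ++ kink up' (Classical (~~ o)) 0 a).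
    by case: (up) (up') => [] [].
  have rl' := rl; rewrite lE kE in rl'; have [W1] := run_shift_drop rl'.
  rewrite -kE => /kink_word[q E].
  apply: (localize (w := [:: a]) (w' := [:: a]) (r0 := [::]) rl' E) => //; rewrite -?kE //.
  + by case: (up) (up') (a) => [] [] [].
  exact: lm_framed_R1.
- have rl' : run W (shift h [:: Cross (Classical o) 0 a b; Cross (Classical (~~ o)) 0 b a]) = Some W'
    by [].
  have [W1] := run_shift_drop rl'; case/run_consP=> u [v [/= su E _]].
  case: u su E => // _ E.
  apply: (localize (w := [:: a; b]) (w' := [:: a; b]) (r0 := [::]) rl' E) => //.
  + by case: (a) (b) => [] [].
  exact: lm_R2.
- have [s [D kE]] : exists s D, kink up Virtual 0 a = s :: D by case: (up); do 2!eexists.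
  have lE : kink up Virtual h a = shift h (kink up Virtual 0 a) by case: (up).
  have rl' := rl; rewrite lE kE in rl'; have [W1] := run_shift_drop rl'.
  rewrite -kE -[kink _ _ _ _]cats0 => /kink_word[q E].
  apply: (localize (w := [:: a]) (w' := [:: a]) (r0 := [::]) rl' E) => //; rewrite -?kE //.
  + by case: (up); case: (a).
  exact: lm_virtual_R1.
- have rl' : run W (shift h [:: Cross Virtual 0 a b; Cross Virtual 0 b a]) = Some W' by [].
  have [W1] := run_shift_drop rl'; case/run_consP=> u [v [/= su E _]].
  case: u su E => // _ E.
  apply: (localize (w := [:: a; b]) (w' := [:: a; b]) (r0 := [::]) rl' E) => //.
  + by case: (a) (b) => [] [].
  exact: lm_virtual_R2.
- have rl' : run W (shift h [:: Cross k12 0 a1 a2; Cross k13 1 a1 a3; Cross k23 0 a2 a3]) = Some W'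
    by [].
  have [W1] := run_shift_drop rl'; case/run_consP=> u [v [su E]].
  case/run_consP=> u2 [v2 [su2 E2 _]]; rewrite /= in su E su2 E2.
  case: u su E E2 => // _ E; case: u2 su2 => [|x [|]] //= _ [_ E2].
  rewrite E2 in E.
  apply: (localize (w := [:: a1; a2; a3]) (w' := [:: a3; a2; a1])
    (r0 := [:: Cross k23 1 a2 a3; Cross k13 0 a1 a3; Cross k12 1 a1 a2]) rl' E) => //; last first.
  + exact: lm_triangle.
  + by case: (a1) (a2) (a3) => [] [] [].
have rl' : run W (shift h [:: Cross Double 0 a b; Cross (Classical o) 0 b a]) = Some W' by [].
have [W1] := run_shift_drop rl'; case/run_consP=> u [v [/= su E _]].
case: u su E => // _ E.
apply: (localize (w := [:: a; b]) (w' := [:: a; b])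
  (r0 := [:: Cross (Classical o) 0 a b; Cross Double 0 b a]) rl' E) => //; last first.
- exact: lm_vertex_turn.
- by case: (a) (b) => [] [].
Qed.

(** * Invariance of the total *)

Definition linking_term (c : category) (D : seq slice) : {freeg flat_class / int} :=
  if c is Unframed then flat_value (unlinked D) else 0.

(** The unlinked class is the same for all crossings, so it is subtracted once, multiplied by the
    total weight. *)
Definition smoothing_total (c : category) (e : bool) (D : seq slice) : {freeg flat_class / int} :=
  smoothing_sum e flat_value D - linking_term c D *~ wsum e D.

Lemma smoothing_total_move c e D D' : applied (move c) D D' -> smoothing_total c e D = smoothing_total c e D'.
Proof.
case=> u v l r m; rewrite /valid !run_cat; case ru: (run _ u) => [W|] //=; rewrite !run_cat.
case rl: (run W l) => [W'|] //= /eqP rv; case rr: (run W r) => [W2|] //= /eqP rv2.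
(* Reading [v] backwards from its right end gives the same word for both sides. *)
have {W2 rv2} rr : run W r = Some W' by rewrite rr (run_inj rv rv2).
have [p [q [w [w' [l0 [r0 [WE W'E lE rE el]]]]]]] := move_localized m rl rr.
have {}el := local_move_regular el.
have ss : sim w w' l0 r0.
  case: el => [[]//|[_ [up [o [a [-> -> -> ->]]]]]]; exact: sim_kink.
have genE u' v' : run [:: true] u' = Some W -> run W' v' = Some [:: true] ->
    flat_value (u' ++ l ++ v') = flat_value (u' ++ r ++ v').
  by rewrite WE W'E lE rE => ru' rv'; case: ss => _ _ /(_ p q); apply.
have linkE : linking_term c (u ++ l ++ v) = linking_term c (u ++ r ++ v).
  rewrite /linking_term /unlinked -!catA; case: (c) => //.
  by apply: genE => //; rewrite run_cat rv.
(* At crossings outside the move, the move can still be performed after smoothing. *)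
have outE : smoothing_sum e (fun x => flat_value (x ++ l ++ v)) u =
    smoothing_sum e (fun x => flat_value (x ++ r ++ v)) u.
  by apply: smoothing_sum_run ru _ => x rx; apply: genE.
have outE' : smoothing_sum e (fun x => flat_value (u ++ l ++ x)) v =
    smoothing_sum e (fun x => flat_value (u ++ r ++ x)) v.
  by apply: smoothing_sum_run rv _ => x rx; apply: genE.
have lrE : smoothing_sum e (fun x => flat_value (u ++ x ++ v)) l - linking_term c (u ++ r ++ v) *~ wsum e l =
    smoothing_sum e (fun x => flat_value (u ++ x ++ v)) r - linking_term c (u ++ r ++ v) *~ wsum e r.
  rewrite lE rE !smoothing_sum_shift !wsum_shift -!rE.
  case: el => [[_ -> H]|[cE [up [o [a [wE w'E l0E r0E]]]]]].
    congr (_ - _); apply: H => x y sxy.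
    by case: sxy => _ _ /(_ p q u v); rewrite -WE -W'E; apply.
  rewrite l0E r0E smoothing_sum_kink wsum_kink /= /wsum big_nil mulr0z.
  (* The smoothed kink has split off a circle, so its class cancels against the linking term. *)
  have -> : flat_value (u ++ shift (size p) (loop up a) ++ v) = linking_term c (u ++ r ++ v).
    rewrite cE /= rE r0E /=; have ru' := ru; have rv' := rv.
    rewrite WE wE in ru'; rewrite W'E w'E in rv'.
    case: (up); last exact: flat_value_circle ru' rv'.
    rewrite -cat_rcons in ru' rv'.
    by have := flat_value_circle a ru' rv'; rewrite size_rcons.
  by rewrite subrr subr0.
have regroup (a x b s y t : {freeg flat_class / int}) :
    a + (x + b) - (s + (y + t)) = a + b - s - t + (x - y).
  by rewrite !opprD [LHS](AC ((1*2)*(1*2)) ((1*3*4*6)*(2*5))).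
by rewrite /smoothing_total linkE !smoothing_sum_cat outE outE' !wsum_cat !mulrzDr !regroup lrE.
Qed.

Lemma equivalent_smoothing_total c e D D' : equivalent c D D' -> smoothing_total c e D = smoothing_total c e D'.
Proof.
by elim=> [x y|x|x y _|x y z _ xy _ yz] //; [apply: smoothing_total_move|rewrite xy].
Qed.

Lemma move_doubles c l r : move c l r -> doubles l = doubles r.
Proof.
have dr n x : is_double (raise n x) = is_double x by case: x.
case=> [s t _|h a|h a|k h a b|k h a b|up o h a _|up up' o h a _|o h a b|up h a|h a b
  |k12 k13 k23 h a1 a2 a3 _|o h a b]; rewrite /doubles /= ?dr //.
- by lia.
- by case: k.
- by case: k.
- by case: up.
- by case: up up' => [] [].
- by case: up.
by lia.
Qed.

Lemma equivalent_doubles c D D' : equivalent c D D' -> doubles D = doubles D'.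
Proof.
elim=> [x y [u v l r m _ _]|//|x y _ ->|x y z _ -> _ ->] //.
by rewrite !doubles_cat (move_doubles m).
Qed.

(** * Comparison with S *)

Lemma smoothing_sum_index (M : zmodType) e (f : seq slice -> M) D :
  smoothing_sum e f D = \sum_(i < size D) f (smoothing i) *~ weight e (slice_at i).
Proof.
elim: D f => [|s D IH] f /=; first by rewrite big_ord0.
rewrite big_ord_recl IH /smoothing /= drop0; congr (_ + _).
apply: eq_bigr => i _; congr (f (s :: take i D ++ smooth_slice _ ++ drop i.+1 D) *~ weight e _).
  by rewrite /slice_at !(tnth_nth s).
by rewrite /slice_at !(tnth_nth s).
Qed.

Lemma wsum_index e D : wsum e D = \sum_(i < size D) weight e (slice_at i).
Proof.
rewrite /wsum (big_nth (Cup 0 true)) big_mkord; apply: eq_bigr => i _.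
by rewrite /slice_at (tnth_nth (Cup 0 true)).
Qed.

Lemma smoothing_invariantE c (K : long_knot) : smoothing_invariant c K = smoothing_total c true (val K).
Proof.
have sumE (F : 'I_(size (val K)) -> {freeg flat_class / int}) :
    \sum_(d : crossing (val K)) F (val d) *~ sgn (slice_at (val d)) =
    \sum_i F i *~ sgn (slice_at i).
  transitivity (\sum_(i | is_classical (slice_at i)) F i *~ sgn (slice_at i)).
    exact/esym/(big_sub [pred i | is_classical (slice_at i)]).
  rewrite big_mkcond; apply: eq_bigr => i _.
  by case: ifP => //; case: (slice_at i) => // -[].
have smE (d : crossing (val K)) : << flat (smoothed d) >> = flat_value (smoothing (val d)).
  have /and3P[v _ /eqP d0] := is_tangle_smoothing (valP K) (valP d).
  by rewrite flat_value_double_free // -value_tangle.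
have linkE : << flat (link0 K) >> = flat_value (unlinked (val K)).
  have /and3P[v _ /eqP d0] := is_tangle_unlinked (valP K).
  by rewrite flat_value_double_free // -value_tangle.
rewrite /smoothing_total smoothing_sum_index wsum_index.
case: c => /=; last first.
  by rewrite mul0rz subr0 -sumE; apply: eq_bigr => d _; rewrite smE.
rewrite mulrz_sumr -sumrB.
transitivity (\sum_i (flat_value (smoothing i) - flat_value (unlinked (val K))) *~ sgn (@slice_at (val K) i)).
  by rewrite -sumE; apply: eq_bigr => d _; rewrite smE linkE.
by apply: eq_bigr => i _; rewrite mulrzBl.
Qed.

(** * Extension to singular knots *)

Lemma flat_value_shadow u s s' v : shadow s = shadow s' -> flat_value (u ++ s :: v) = flat_value (u ++ s' :: v).
Proof. by move=> e; rewrite /flat_value !map_cat /= e. Qed.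

Definition crossing_term c u s v : {freeg flat_class / int} :=
  flat_value (u ++ smooth_slice s ++ v) - linking_term c (u ++ s :: v).

(** All other terms, and all flat classes involved, see only the shadow of the slice at this place;
    [A] collects them. *)
Lemma smoothing_total_split c e u s v : exists A, forall x, shadow x = shadow s ->
  smoothing_total c e (u ++ x :: v) = A + crossing_term c u s v *~ weight e x.
Proof.
exists (smoothing_sum e (fun y => flat_value (y ++ s :: v)) u +
    smoothing_sum e (fun y => flat_value (u ++ s :: y)) v -
    linking_term c (u ++ s :: v) *~ (wsum e u + wsum e v)) => x xs.
have linkE : linking_term c (u ++ x :: v) = linking_term c (u ++ s :: v).
  by rewrite /linking_term /unlinked -!catA; case: (c) => //; apply: flat_value_shadow.
rewrite /smoothing_total linkE smoothing_sum_cat /=.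
rewrite (@eq_smoothing_sum _ _ _ (fun y => flat_value (y ++ s :: v)) u); last by move=> y; apply: flat_value_shadow.
rewrite (@eq_smoothing_sum _ _ _ (fun y => flat_value (u ++ s :: y)) v); last by move=> y; apply: flat_value_shadow.
have -> : smooth_slice x = smooth_slice s.
  by case: s x xs {linkE} => [k h a b|h a|h a] [k' h' a' b'|h' a'|h' a'] //= => [[_ -> -> ->]|[-> ->]|[-> ->]].
rewrite wsum_cat /wsum big_cons -/(wsum e u) -/(wsum e v) /crossing_term.
rewrite mulrzBl !mulrzDr !opprD.
by rewrite [LHS](AC ((1*2)*(1*2)) ((1*3)*(4*6)*(2*5))).
Qed.

Lemma smoothing_total_no_doubles c D : doubles D = 0%N -> smoothing_total c false D = 0.
Proof.
move=> dD; have w0 : wsum false D = 0.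
  by elim: D dD => [|s D IH] dD; rewrite /wsum ?big_nil // big_cons -/(wsum _ _) IH;
    move: dD; rewrite /doubles /=; case: is_double.
have sm0 f : smoothing_sum false f D = 0 :> {freeg flat_class / int}.
  elim: D f dD {w0} => //= s D IH f; rewrite /doubles /= /weight.
  by case: is_double => // /IH->; rewrite mulr0z addr0.
by rewrite /smoothing_total w0 sm0 mulr0z subr0.
Qed.

(** The factor 2 is the jump of the sign from -1 to 1 at the double point. *)
Definition extension (c : category) (K : singular_knot) : {freeg flat_class / int} :=
  match doubles (val K) with
  | 0 => smoothing_total c true (val K)
  | 1 => smoothing_total c false (val K) *+ 2
  | _ => 0
  end.

Lemma sgn_flip o h a b : sgn (Cross (Classical (~~ o)) h a b) = - sgn (Cross (Classical o) h a b).
Proof. exact: (weight_opposite true). Qed.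

Lemma smoothing_total_resolution c u v h a b o :
  sgn (Cross (Classical o) h a b) = 1 ->
  smoothing_total c true (u ++ Cross (Classical o) h a b :: v) -
  smoothing_total c true (u ++ Cross (Classical (~~ o)) h a b :: v) =
  crossing_term c u (Cross Double h a b) v *+ 2.
Proof.
move=> s1; have [A AE] := smoothing_total_split c true u (Cross Double h a b) v.
by rewrite !AE // /weight sgn_flip s1 mulrN1z mulr1z opprD opprK addrACA subrr add0r mulr2n.
Qed.

Lemma smoothing_total_double c u v h a b : doubles u = 0%N -> doubles v = 0%N ->
  smoothing_total c false (u ++ Cross Double h a b :: v) = crossing_term c u (Cross Double h a b) v.
Proof.
move=> du dv; have [A AE] := smoothing_total_split c false u (Cross Double h a b) v.
(* With a classical crossing in place of the only double point the total is 0, which shows [A] to be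
   0. *)
have /esym := AE (Cross (Classical true) h a b) erefl.
rewrite smoothing_total_no_doubles; last by rewrite doubles_cat /doubles /= -!/(doubles _) du dv.
by rewrite /= mulr0z addr0 => A0; rewrite AE // A0 add0r.
Qed.

Lemma extension_resolution c K Kp Km :
  resolution K Kp Km -> extension c K = extension c Kp - extension c Km.
Proof.
case=> u [v [h [a [b [o [s1 KE KpE KmE]]]]]].
have d x : doubles (u ++ x :: v) = (doubles u + (is_double x + doubles v))%N.
  by rewrite doubles_cat.
rewrite /extension KE KpE KmE !d /= addnCA add0n add1n.
case dE: (doubles u + doubles v)%N => [|[|n]].
- have [du dv] : doubles u = 0%N /\ doubles v = 0%N by lia.
  by rewrite smoothing_total_double // smoothing_total_resolution.
(* Of two double points one is resolved: classical crossings of either sign have weight 0 for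
   [e = false], so the two values coincide. *)
- have [A AE] := smoothing_total_split c false u (Cross Double h a b) v.
  by rewrite !AE //= subrr.
by rewrite subrr.
Qed.

Lemma smoothing_invariant_order_le1 c : vassiliev_order_le c (smoothing_invariant c) 1.
Proof.
split=> [K K' KK'|]; first by rewrite !smoothing_invariantE (equivalent_smoothing_total _ KK').
exists (extension c); split; first split.
- move=> K; rewrite smoothing_invariantE /extension /=.
  by have /andP[_ /eqP->] := valP K.
- exact: extension_resolution.
- move=> K K' KK'; rewrite /extension (equivalent_doubles KK').
  by rewrite !(equivalent_smoothing_total _ KK').
by move=> K; rewrite /extension; case: (doubles _) => [|[]].
Qed.

(** * Signed intersection numbers from colourings *)

Definition orient (a : bool) : int := if a then 1 else - 1.

(* The strands carry colours, constant along each component.  A classical     *)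
(* crossing of a strand of colour 1 with a strand of colour 0 is counted with *)
(* the sign of their intersection.  The pair lists the colours on the right   *)
(* of the slice and the count.  Double points must be counted like classical  *)
(* crossings: turning one over exchanges it with a classical crossing.        *)
Definition local_colorings (s : slice) (x : seq bool) : seq (seq bool * int) :=
  match s, x with
  | Cross k _ a b, [:: p; q] =>
      [:: ([:: q; p], if k is Virtual then 0 else (q%:Z - p%:Z) * (orient a * orient b))]
  | Cap _ _, [:: p; q] => if p == q then [:: ([::], 0)] else [::]
  | Cup _ _, [::] => [:: ([:: true; true], 0); ([:: false; false], 0)]
  | _, _ => [::]
  end.

Definition slice_colorings (s : slice) (x : seq bool) : seq (seq bool * int) :=
  let h := height s in let m := size (lhs s) in
  [seq (take h x ++ z.1 ++ drop (h + m) x, z.2) | z <- local_colorings s (take m (drop h x))].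

Fixpoint colorings (D : seq slice) (x : seq bool) : seq (seq bool * int) :=
  if D is s :: D' then
    [seq (y.1, z.2 + y.2) | z <- slice_colorings s x, y <- colorings D' z.1]
  else [:: (x, 0)].

Lemma colorings_consP s D x y n :
  reflect (exists z k m, [/\ (z, k) \in slice_colorings s x, (y, m) \in colorings D z & n = k + m])
    ((y, n) \in colorings (s :: D) x).
Proof.
apply: (iffP allpairsPdep) => [[[z k] [[y' m] [zk ym [-> ->]]]]|[z [k [m [zk ym ->]]]]].
  by exists z, k, m.
by exists (z, k), (y, m).
Qed.

Lemma colorings_catP D D' x y n :
  (y, n) \in colorings (D ++ D') x <->
  exists z k m, [/\ (z, k) \in colorings D x, (y, m) \in colorings D' z & n = k + m].
Proof.
elim: D x n => [|s D IH] x n.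
  split=> [yn|[z [k [m [/= + ym ->]]]]]; first by exists x, 0, n; rewrite add0r mem_seq1.
  by rewrite mem_seq1 => /eqP[<- ->]; rewrite add0r.
split=> [/colorings_consP[z [k [m [zk /IH[z' [k' [m' [zk' ym' ->]]]] ->]]]]|].
  by exists z', (k + k'), m'; split; rewrite ?addrA //; apply/colorings_consP; exists z, k, k'.
move=> [z [k [m [/colorings_consP[z' [k' [m' [zk' zm' ->]]]] ym ->]]]].
apply/colorings_consP; exists z', k', (m' + m); split; rewrite ?addrA //.
by apply/IH; exists z, m', m.
Qed.

Lemma slice_colorings_cat u x v s : size u = height s -> size x = size (lhs s) ->
  slice_colorings s (u ++ x ++ v) = [seq (u ++ z.1 ++ v, z.2) | z <- local_colorings s x].
Proof.
move=> su sx; rewrite /slice_colorings /= -su -sx [in drop (_ + _)%N]addnC -drop_drop.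
by rewrite !drop_size_cat // !take_size_cat.
Qed.

Lemma split_word (w u l v : seq bool) : size w = size (u ++ l ++ v) ->
  exists u' l' v', [/\ w = u' ++ l' ++ v', size u' = size u, size l' = size l & size v' = size v].
Proof.
rewrite !size_cat => sw; exists (take (size u) w), (take (size l) (drop (size u) w)),
  (drop (size l) (drop (size u) w)).
rewrite !cat_take_drop !size_drop size_takel; last by lia.
by rewrite size_takel ?size_drop; [split=> //; lia|lia].
Qed.

Lemma size_local_colorings s x z : z \in local_colorings s x -> size z.1 = size (rhs s).
Proof.
case: s x => [k h a b|h a|h a] [|p [|q []]] //=.
- by rewrite mem_seq1 => /eqP->.
- by case: eqP => // _; rewrite mem_seq1 => /eqP->.
by rewrite !inE => /orP[] /eqP->.
Qed.

Lemma size_slice_colorings w w' s x z : step w s = Some w' -> size x = size w ->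
  z \in slice_colorings s x -> size z.1 = size w'.
Proof.
move=> /stepP[u [v [su -> ->]]] /split_word[u' [x' [v' [-> su' sx sv]]]].
rewrite slice_colorings_cat ?su' // => /mapP[t /size_local_colorings st ->] /=.
by rewrite !size_cat su' st sv.
Qed.

Lemma size_colorings w w' D x z : run w D = Some w' -> size x = size w ->
  z \in colorings D x -> size z.1 = size w'.
Proof.
elim: D w x z => [|s D IH] w x [y n] /=; first by case=> -> sx; rewrite mem_seq1 => /eqP[-> _].
case st: (step w s) => [w1|] //= rD sx /colorings_consP[z [k [m [zk ym _]]]].
exact: IH rD (size_slice_colorings st sx zk) ym.
Qed.

Lemma colorings_frame p q w w' D x : run w D = Some w' -> size x = size w ->
  colorings (shift (size p) D) (p ++ x ++ q) =
  [seq (p ++ z.1 ++ q, z.2) | z <- colorings D x].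
Proof.
elim: D w x => [|s D IH] w x //=; case st: (step w s) => [w1|] //= rD sx.
have -> : slice_colorings (raise (size p) s) (p ++ x ++ q) =
    [seq (p ++ z.1 ++ q, z.2) | z <- slice_colorings s x].
  have [u [v [su wE _]]] := stepP st; rewrite wE in sx.
  have [u' [x' [v' [-> su' sx' _]]]] := split_word sx.
  rewrite [slice_colorings s _]slice_colorings_cat ?su' // -map_comp.
  have := @slice_colorings_cat (p ++ u') x' (v' ++ q) (raise (size p) s).
  rewrite height_raise lhs_raise size_cat su' su addnC -!catA => -> //.
  have -> : local_colorings (raise (size p) s) x' = local_colorings s x' by case: (s).
  by apply: eq_map => z /=; rewrite -!catA.
move: (fun z => @size_slice_colorings _ _ _ _ z st sx); move: (slice_colorings s x) => cs cs_size.
rewrite map_flatten -!map_comp; congr flatten; apply/eq_in_map => z /cs_size sz /=.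
by rewrite (IH w1) // -!map_comp.
Qed.

(** Sets of colourings are compared, since exchanging two cups changes the order of the list. All
    cases but the exchange are finite checks. *)
Lemma colorings_local_move c w w' l r x : local_move c w w' l r -> size x = size w ->
  colorings l x =i colorings r x.
Proof.
case.
- move=> u m v s t su st.
  move=> /split_word[u' [x1 [y [-> su' sx1 /split_word[m' [x2 [v' [-> sm' sx2 _]]]]]]]].
  have mid n z : size z = n -> slice_colorings (raise n t) (u' ++ z ++ m' ++ x2 ++ v') =
      [seq (u' ++ z ++ m' ++ y.1 ++ v', y.2) | y <- local_colorings t x2].
    move=> sz; have := @slice_colorings_cat (u' ++ z ++ m') x2 v' (raise n t).
    rewrite height_raise lhs_raise !size_cat su' sm' st sz -!catA => ->; [|lia|by []].
    by rewrite (_ : local_colorings _ _ = local_colorings t x2);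
      [apply: eq_map => z' /=; rewrite -!catA | case: (t)].
  move=> [a n]; apply/colorings_consP/colorings_consP.
  + move=> [z [k [j [+ /colorings_consP[z' [k' [j' [+ + ->]]]] ->]]]].
    rewrite slice_colorings_cat ?su' // => /mapP[[y1 n1] y1s [-> ->]] /=.
    rewrite mid ?(size_local_colorings y1s) // => /mapP[[y2 n2] y2s [-> ->]] /=.
    rewrite mem_seq1 => /eqP[-> ->].
    exists (u' ++ x1 ++ m' ++ y2 ++ v'), n2, n1; split.
    * by rewrite mid ?sx1 //; apply/mapP; exists (y2, n2).
    * apply/(@colorings_consP s [::]); exists (u' ++ y1 ++ m' ++ y2 ++ v'), n1, 0; split; rewrite ?addr0 //.
        by rewrite slice_colorings_cat ?su' //; apply/mapP; exists (y1, n1).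
      by rewrite mem_seq1.
    by rewrite addr0 addrC.
  move=> [z [k [j [+ /colorings_consP[z' [k' [j' [+ + ->]]]] ->]]]].
  rewrite mid ?sx1 // => /mapP[[y2 n2] y2s [-> ->]] /=.
  rewrite slice_colorings_cat ?su' // => /mapP[[y1 n1] y1s [-> ->]] /=.
  rewrite mem_seq1 => /eqP[-> ->].
  exists (u' ++ y1 ++ m' ++ x2 ++ v'), n1, n2; split.
  + by rewrite slice_colorings_cat ?su' //; apply/mapP; exists (y1, n1).
  + apply/(@colorings_consP (raise (size (rhs s)) t) [::]); exists (u' ++ y1 ++ m' ++ y2 ++ v'), n2, 0; split; rewrite ?addr0 //.
      by rewrite mid ?(size_local_colorings y1s) //; apply/mapP; exists (y2, n2).
    by rewrite mem_seq1.
  by rewrite addr0 addrC.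
- by move=> a; case: x => [|p []] // _; case: p a => [] [].
- by move=> a; case: x => [|p []] // _; case: p a => [] [].
- by move=> k a b; case: x => [|p [|q [|t []]]] // _;
    case: k p q t a b => [o||] [] [] [] [] [].
- by move=> k a b; case: x => [|p []] // _; case: k p a b => [o||] [] [] [].
- by move=> up o a _; case: x => [|p []] // _; case: up p a => [] [] [].
- by move=> up up' o a; case: x => [|p []] // _; case: up up' p a => [] [] [] [].
- by move=> o a b; case: x => [|p [|q []]] // _; case: p q a b => [] [] [] [].
- by move=> up a; case: x => [|p []] // _; case: up p a => [] [] [].
- by move=> a b; case: x => [|p [|q []]] // _; case: p q a b => [] [] [] [].
- move=> k12 k13 k23 a1 a2 a3 _; case: x => [|p [|q [|t []]]] // _.
  by case: k12 k13 k23 p q t a1 a2 a3 => [o||] [o'||] [o''||] [] [] [] [] [] [].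
by move=> o a b; case: x => [|p [|q []]] // _; case: p q a b => [] [] [] [].
Qed.

(** The long component gets colour 0, closed components any colour. For a two-component tangle the
    counts are 0 and the signed number of classical intersections of the closed component with the
    long one. *)
Definition linking_numbers (D : seq slice) (n : int) : bool :=
  ([:: false], n) \in colorings D [:: false].

Lemma colorings_context u v l r n W W' :
    run [:: true] u = Some W -> run W l = Some W' -> run W r = Some W' ->
    (forall x, size x = size W -> colorings l x =i colorings r x) ->
  linking_numbers (u ++ l ++ v) n = linking_numbers (u ++ r ++ v) n.
Proof.
move=> ru rl rr lr; apply/idP/idP=> /colorings_catP[z [k [m [zk /colorings_catP[z' [k' [m' [zk' ym' ->]]]] ->]]]];
have sz := size_colorings (x := [:: false]) ru erefl zk; apply/colorings_catP; exists z, k, (k' + m'); split=> //;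
apply/colorings_catP; exists z', k', m'; split=> //; by rewrite ?lr // -lr.
Qed.

Lemma flat_linking_numbers c D D' n : flat_equivalent c D D' ->
  linking_numbers D n = linking_numbers D' n.
Proof.
elim=> [x y [u v l r m]|//|x y _ ->|x y z _ -> _ ->] //; rewrite /valid !run_cat.
case ru: (run _ u) => [W|] //=; rewrite !run_cat.
case rl: (run W l) => [W'|] //= /eqP rv; case rr: (run W r) => [W2|] //= /eqP rv2.
have {W2 rv2} rr : run W r = Some W' by rewrite rr (run_inj rv rv2).
apply: (colorings_context _ _ ru rl rr) => X sX.
(* Over and under do not enter the count, so a crossing change alters nothing. *)
case: m rl rr => [{}l {}r m|o h a b] rl rr; last by [].
have [p [q [w [w' [l0 [r0 [WE W'E lE rE lm]]]]]]] := move_localized m rl rr.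
have [r1 r2] : run w l0 = Some w' /\ run w r0 = Some w'.
  case: (local_move_regular lm) => [[[]]//|[_ [up [o [a [-> -> -> ->]]]]]].
  by case: (sim_kink up (Classical o) a).
rewrite WE in sX; have [p' [x' [q' [-> sp sx' _]]]] := split_word sX.
rewrite lE rE -sp (colorings_frame _ _ r1 sx') (colorings_frame _ _ r2 sx').
by apply: eq_mem_map; apply: colorings_local_move lm sx'.
Qed.

(** * A virtual trefoil with nonzero jump *)

Definition virtual_trefoil (s : slice) : seq slice :=
  [:: Cup 1 true; s; Cross (Classical true) 0 true true; Cross Virtual 0 true true; Cap 1 true].

Definition virtual_trefoil_smoothed : tangle.
Proof.
by exists [:: Cup 1 true; Cross (Classical true) 0 true true; Cross Virtual 0 true true; Cap 1 true].
Defined.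

Definition virtual_trefoil_linked : tangle.
Proof. by exists (unlinked (virtual_trefoil (Cross (Classical true) 0 true true))). Defined.

(** The count 1 occurs on the smoothing, where the components meet in one classical crossing, but
    not beside a split circle. *)
Lemma virtual_trefoil_smoothed_linked : flat virtual_trefoil_smoothed != flat virtual_trefoil_linked.
Proof.
by apply/eqP => /eqmodP/asboolP e; have := flat_linking_numbers 1 e.
Qed.

Lemma virtual_trefoil_crossing_term c :
  crossing_term c [:: Cup 1 true] (Cross Double 0 true true)
    [:: Cross (Classical true) 0 true true; Cross Virtual 0 true true; Cap 1 true] *+ 2 <> 0.
Proof.
have genE (T : tangle) : flat_value (val T) = << flat T >>.
  by have /and3P[v _ /eqP d0] := valP T; rewrite flat_value_double_free // value_tangle.
have linkE : linking_term Unframed (virtual_trefoil (Cross Double 0 true true)) = << flat virtual_trefoil_linked >>.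
  exact: genE virtual_trefoil_linked.
have -> : crossing_term c [:: Cup 1 true] (Cross Double 0 true true)
    [:: Cross (Classical true) 0 true true; Cross Virtual 0 true true; Cap 1 true] =
    << flat virtual_trefoil_smoothed >> - linking_term c (virtual_trefoil (Cross Double 0 true true)).
  by congr (_ - _); apply: (genE virtual_trefoil_smoothed).
(* At the class of the smoothing the coefficient is 2 (1 - 0). *)
move/(congr1 (coeff (flat virtual_trefoil_smoothed))).
rewrite coeffMn coeff0 coeffB coeffU eqxx.
have -> : coeff (flat virtual_trefoil_smoothed) (linking_term c (virtual_trefoil (Cross Double 0 true true))) = 0.
  case: c; last by rewrite /linking_term coeff0.
  by rewrite linkE coeffU eq_sym (negPf virtual_trefoil_smoothed_linked).
by [].
Qed.

(** Any extension takes the jump of S as its value on a single double point, so order 0 would make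
    this jump vanish. *)
Lemma smoothing_invariant_not_order_le0 c : ~ vassiliev_order_le c (smoothing_invariant c) 0.
Proof.
case=> _ [nus [[nusK nusR _] nus0]].
pose K : singular_knot := Sub (virtual_trefoil (Cross Double 0 true true)) isT.
pose Kc o : long_knot := Sub (virtual_trefoil (Cross (Classical o) 0 true true)) isT.
(* Both strands run to the right, so the positive crossing is the one with [o = false]. *)
have res : resolution K (singular_of (Kc false)) (singular_of (Kc true)).
  by exists [:: Cup 1 true], [:: Cross (Classical true) 0 true true; Cross Virtual 0 true true; Cap 1 true],
    0%N, true, true, false.
have := nusR _ _ _ res; rewrite nus0 // !nusK !smoothing_invariantE => /esym.
rewrite (smoothing_total_resolution c [:: Cup 1 true] [:: Cross (Classical true) 0 true true;
  Cross Virtual 0 true true; Cap 1 true] (h := 0) (a := true) (b := true) (o := false)) //.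
exact: virtual_trefoil_crossing_term.
Qed.

Theorem proposition13 (c : category) :
  vassiliev_order_one c (smoothing_invariant c).
Proof.
split; [exact: smoothing_invariant_order_le1 | exact: smoothing_invariant_not_order_le0].
Qed.
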